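(* Let $\vartheta$ be a symmetric bivector field on a smooth manifold $M$ and let $\gamma:I\to M$ be a $\vartheta$-admissible curve defined on some open interval $I\subseteq\mathbb{R}$. Then the function $\mathrm{Sq}_\vartheta(\dot\gamma):I\to\mathbb{R}$ given by $\mathrm{Sq}_\vartheta(\dot\gamma)(t):=g_\vartheta(\dot\gamma(t),\dot\gamma(t))$ for $t\in I$ is smooth. If, in addition, $(\vartheta,\nabla)$ is a symmetric Poisson structure and $\gamma$ is a geodesic of $\nabla$, then the function $\mathrm{Sq}_\vartheta(\dot\gamma)$ is constant.
   Context: All curves are smooth. A symmetric bivector field $\vartheta\in\Gamma(\mathrm{Sym}^2TM)$ is viewed as a map $\vartheta:T^*M\to TM$ by $\beta(\vartheta(\alpha))=\vartheta(\alpha,\beta)$. Its characteristic metric is the family, over $m\in M$, of non-degenerate symmetric bilinear forms $g_{\vartheta_m}$ on $(\mathrm{im}\,\vartheta)_m\subseteq T_mM$ given by $g_{\vartheta_m}(\vartheta(\alpha),\vartheta(\beta)):=\vartheta(\alpha,\beta)$ for $\alpha,\beta\in T_m^*M$; for $u,w\in(\mathrm{im}\,\vartheta)_m$ write $g_\vartheta(u,w)=g_{\vartheta_m}(u,w)$. A curve $\gamma:I\to M$ on an open interval is $\vartheta$-admissible if there is a curve $a:I\to T^*M$ such that $\vartheta(a(t))=\dot\gamma(t)$ for all $t\in I$. For a connection $\nabla$ and vector fields put $[X,Y]_s:=\nabla_XY+\nabla_YX$; the symmetric Schouten bracket is the unique $\mathbb{R}$-bilinear commutative map $[\cdot,\cdot]_s$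 on $\bigoplus_r\Gamma(\mathrm{Sym}^rTM)$ extending it, with $[X,f]_s=Xf$, and such that for $\mathcal{X}$ of degree $r$, $[\mathcal{X},\cdot]_s$ is a degree-$(r-1)$ derivation of the symmetric product $\odot$ (normalized by $X\odot Y=X\otimes Y+Y\otimes X$). A symmetric Poisson structure is a pair $(\vartheta,\nabla)$ of a symmetric bivector field and a torsion-free connection with $[\vartheta,\vartheta]_s=0$. *)

(* Defs.v *)
From HB Require Import structures.
From mathcomp Require Import all_boot all_order all_algebra.
From mathcomp Require Import all_classical all_reals all_analysis.

Set Implicit Arguments.
Unset Strict Implicit.
Unset Printing Implicit Defensive.

Import Order.TTheory GRing.Theory Num.Theory.
Import numFieldNormedType.Exports.
Local Open Scope classical_set_scope.
Local Open Scope ring_scope.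

(** * Smooth maps between normed spaces *)

(* For a finite-dimensional V and an open U this is the usual notion of a C^k
   map: all iterated directional derivatives up to order k exist on U and are
   continuous there.  Only the values of f on U matter when U is open. *)
Fixpoint Ck_on (R : realType) (V W : normedModType R) (k : nat) (U : set V)
    (f : V -> W) : Prop :=
  (forall x, U x -> {for x, continuous f}) /\
  match k with
  | 0 => True
  | k'.+1 => forall v : V, (forall x, U x -> derivable f x v) /\
                           Ck_on k' U (fun x => 'D_v f x : W)
  end.

Definition smooth_on (R : realType) (V W : normedModType R) (U : set V)
    (f : V -> W) : Prop := forall k, Ck_on k U f.

(** * Smooth manifolds *)

(* A homeomorphism from an open subset of T onto an open subset of R^n; cmap
   and cinv are total functions whose values off cdom and cimg are junk. *)
Record chart (R : realType) (n : nat) (T : topologicalType) := Chart {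
  cdom : set T;
  cmap : T -> 'rV[R]_n;
  cinv : 'rV[R]_n -> T;
  cdom_open : open cdom;
  cimg_open : open (cmap @` cdom);
  cmapK : forall m, cdom m -> cinv (cmap m) = m;
  cmap_continuous : forall m, cdom m -> {for m, continuous cmap};
  cinv_continuous : forall x, (cmap @` cdom) x -> {for x, continuous cinv}
}.

Definition cimg (R : realType) (n : nat) (T : topologicalType)
    (c : chart R n T) : set 'rV[R]_n := cmap c @` cdom c.

Record smooth_manifold (R : realType) (n : nat) := SmoothManifold {
  msort :> topologicalType;
  atlas : set (chart R n msort);
  m_hausdorff : hausdorff_space msort;
  m_second_countable : @second_countable msort;
  atlas_cover : forall m : msort, exists2 c, atlas c & cdom c m;
  atlas_smooth : forall c c', atlas c -> atlas c' ->
    smooth_on (cmap c @` (cdom c `&` cdom c')) (cmap c' \o cinv c)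
}.

Arguments atlas {R n} s _.

Section Manifold.
Variables (R : realType) (n : nat) (M : smooth_manifold R n).

(** ** Tangent and cotangent spaces *)

(* A chart of the atlas around m, chosen once and for all.  T_mM is identified
   with 'rV[R]_n by reading tangent vectors in this chart, and T*_mM with the
   dual space 'cV[R]_n of 'rV[R]_n.  The smooth structures of TM and T*M are
   the usual ones: they are described below by passing to the components in
   an arbitrary chart c of the atlas. *)
Definition chart_at (m : M) : chart R n M := s2val (cid2 (atlas_cover m)).

Definition pairing (alpha : 'cV[R]_n) (v : 'rV[R]_n) : R := (v *m alpha) 0 0.

(* components, in the chart c, of v in T_mM *)
Definition tcoord (c : chart R n M) (m : M) (v : 'rV[R]_n) : 'rV[R]_n :=
  'D_v (cmap c \o cinv (chart_at m)) (cmap (chart_at m) m).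

(* the coordinate vector d/dx^i in T_mM of the chart c *)
Definition coord_vec (c : chart R n M) (m : M) (i : 'I_n) : 'rV[R]_n :=
  'D_(delta_mx 0 i) (cmap (chart_at m) \o cinv c) (cmap c m).

(* the coordinate covector dx^i in T*_mM of the chart c *)
Definition coord_covec (c : chart R n M) (m : M) (i : 'I_n) : 'cV[R]_n :=
  \col_j tcoord c m (delta_mx 0 j) 0 i.

(** ** Functions and vector fields *)

Definition smooth_fun (f : M -> R) : Prop :=
  forall c, atlas M c -> smooth_on (cimg c) (f \o cinv c).

Definition smooth_vf (X : M -> 'rV[R]_n) : Prop :=
  forall c, atlas M c ->
    smooth_on (cimg c) (fun x => tcoord c (cinv c x) (X (cinv c x))).

(* the function X f *)
Definition vf_act (X : M -> 'rV[R]_n) (f : M -> R) (m : M) : R :=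
  'D_(X m) (f \o cinv (chart_at m)) (cmap (chart_at m) m).

(** ** Affine connections *)

Record is_connection
    (nabla : (M -> 'rV[R]_n) -> (M -> 'rV[R]_n) -> M -> 'rV[R]_n) : Prop := {
  conn_smooth : forall X Y, smooth_vf X -> smooth_vf Y ->
    smooth_vf (nabla X Y);
  conn_addl : forall X X' Y m,
    smooth_vf X -> smooth_vf X' -> smooth_vf Y ->
    nabla (fun p => X p + X' p) Y m = nabla X Y m + nabla X' Y m;
  conn_scalel : forall f X Y m,
    smooth_fun f -> smooth_vf X -> smooth_vf Y ->
    nabla (fun p => f p *: X p) Y m = f m *: nabla X Y m;
  conn_addr : forall X Y Y' m,
    smooth_vf X -> smooth_vf Y -> smooth_vf Y' ->
    nabla X (fun p => Y p + Y' p) m = nabla X Y m + nabla X Y' m;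
  conn_leibniz : forall f X Y m,
    smooth_fun f -> smooth_vf X -> smooth_vf Y ->
    nabla X (fun p => f p *: Y p) m = vf_act X f m *: Y m + f m *: nabla X Y m
}.

(* nabla_X Y - nabla_Y X is the Lie bracket of X and Y, the latter being the
   vector field acting on functions as the commutator of X and Y *)
Definition torsion_free
    (nabla : (M -> 'rV[R]_n) -> (M -> 'rV[R]_n) -> M -> 'rV[R]_n) : Prop :=
  forall X Y f m, smooth_vf X -> smooth_vf Y -> smooth_fun f ->
    vf_act (fun p => nabla X Y p - nabla Y X p) f m =
    vf_act X (vf_act Y f) m - vf_act Y (vf_act X f) m.

(** ** The algebra of symmetric multivector fields *)

(* An element of Sym T_mM, the direct sum of all Sym^r T_mM, is encoded as a
   function on finite sequences of covectors: its degree r component is the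
   symmetric r-linear form obtained by restriction to sequences of length r. *)
Definition symfield := M -> seq 'cV[R]_n -> R.

(* sections of the direct sum over r of Gamma(Sym^r TM) *)
Record is_symfield (P : symfield) : Prop := {
  symf_sym : forall m s s', perm_eq s s' -> P m s = P m s';
  symf_linear : forall m a alpha beta s,
    P m (a *: alpha + beta :: s) = a * P m (alpha :: s) + P m (beta :: s);
  symf_finite : exists N : nat, forall m s, (N < size s)%N -> P m s = 0;
  symf_smooth : forall c (s : seq 'I_n), atlas M c ->
    smooth_on (cimg c)
      (fun x => P (cinv c x) [seq coord_covec c (cinv c x) i | i <- s])
}.

Definition homogeneous (r : nat) (P : symfield) : Prop :=
  forall m s, size s <> r -> P m s = 0.

Definition sym_of_fun (f : M -> R) : symfield :=
  fun m s => if s is [::] then f m else 0.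

Definition sym_of_vf (X : M -> 'rV[R]_n) : symfield :=
  fun m s => if s is [:: alpha] then pairing alpha (X m) else 0.

(* A bit sequence b splits s into two complementary subsequences, so on
   homogeneous P and Q of degrees r and r' this is the sum over all
   (r, r')-shuffles; in particular X (.) Y = X (x) Y + Y (x) X in degree 1. *)
Definition sym_mul (P Q : symfield) : symfield :=
  fun m s => \sum_(b : (size s).-tuple bool)
    P m (mask b s) * Q m (mask [seq ~~ x | x <- b] s).

(** ** The symmetric Schouten bracket *)

(* The case r = r' = 0 of schouten_degree says that the bracket of two
   functions, being of degree -1, vanishes. *)
Record is_schouten
    (nabla : (M -> 'rV[R]_n) -> (M -> 'rV[R]_n) -> M -> 'rV[R]_n)
    (B : symfield -> symfield -> symfield) : Prop := {
  schouten_section : forall P Q, is_symfield P -> is_symfield Q ->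
    is_symfield (B P Q);
  schouten_linear : forall (a : R) P P' Q m s,
    is_symfield P -> is_symfield P' -> is_symfield Q ->
    B (fun p l => a * P p l + P' p l) Q m s = a * B P Q m s + B P' Q m s;
  schouten_comm : forall P Q m s, is_symfield P -> is_symfield Q ->
    B P Q m s = B Q P m s;
  schouten_degree : forall r r' P Q m s,
    is_symfield P -> is_symfield Q -> homogeneous r P -> homogeneous r' Q ->
    (size s).+1 <> (r + r')%N -> B P Q m s = 0;
  schouten_derivation : forall r P Q Q' m s,
    is_symfield P -> is_symfield Q -> is_symfield Q' -> homogeneous r P ->
    B P (sym_mul Q Q') m s =
    sym_mul (B P Q) Q' m s + sym_mul Q (B P Q') m s;
  schouten_vf_fun : forall X f m s, smooth_vf X -> smooth_fun f ->
    B (sym_of_vf X) (sym_of_fun f) m s = sym_of_fun (vf_act X f) m s;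
  schouten_vf_vf : forall X Y m s, smooth_vf X -> smooth_vf Y ->
    B (sym_of_vf X) (sym_of_vf Y) m s =
    sym_of_vf (fun p => nabla X Y p + nabla Y X p) m s
}.

(** ** Symmetric bivector fields *)

Definition is_sym_bivector (vt : symfield) : Prop :=
  is_symfield vt /\ homogeneous 2 vt.

(* the vector vt(alpha) in T_mM: its i-th component is its pairing with the
   i-th element of the standard basis of T*_mM *)
Definition sharp (vt : symfield) (m : M) (alpha : 'cV[R]_n) : 'rV[R]_n :=
  \row_i vt m [:: alpha; delta_mx i 0].

(* the characteristic metric at m, with value 0 off the image of vt *)
Definition char_metric (vt : symfield) (m : M) (u w : 'rV[R]_n) : R :=
  xget 0 [set x | exists alpha beta,
    [/\ sharp vt m alpha = u, sharp vt m beta = w & x = vt m [:: alpha; beta]]].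

(* The bracket B is unique by its defining properties. *)
Definition sym_poisson (vt : symfield)
    (nabla : (M -> 'rV[R]_n) -> (M -> 'rV[R]_n) -> M -> 'rV[R]_n) : Prop :=
  [/\ is_sym_bivector vt, is_connection nabla, torsion_free nabla &
      exists2 B, is_schouten nabla B & forall m s, B vt vt m s = 0].

(** ** Curves *)

(* A curve defined on an open interval I is a function on R, of which only
   the values on I are relevant. *)
Definition smooth_curve (I : set R) (gamma : R -> M) : Prop :=
  (forall t, I t -> {for t, continuous gamma}) /\
  (forall c, atlas M c ->
    smooth_on (I `&` gamma @^-1` cdom c) (cmap c \o gamma)).

Definition velocity (gamma : R -> M) (t : R) : 'rV[R]_n :=
  derive1 (cmap (chart_at (gamma t)) \o gamma) t.

(* smooth curves in TM and in T*M whose projection to M is gamma *)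
Definition smooth_vf_along (I : set R) (gamma : R -> M)
    (V : R -> 'rV[R]_n) : Prop :=
  forall c, atlas M c ->
    smooth_on (I `&` gamma @^-1` cdom c) (fun t => tcoord c (gamma t) (V t)).

Definition smooth_cf_along (I : set R) (gamma : R -> M)
    (a : R -> 'cV[R]_n) : Prop :=
  forall c (i : 'I_n), atlas M c ->
    smooth_on (I `&` gamma @^-1` cdom c)
      (fun t => pairing (a t) (coord_vec c (gamma t) i)).

(* vt(a(t)) = gamma'(t) in TM forces a(t) to lie over gamma(t). *)
Definition admissible (vt : symfield) (I : set R) (gamma : R -> M) : Prop :=
  smooth_curve I gamma /\
  exists2 a, smooth_cf_along I gamma a &
    forall t, I t -> sharp vt (gamma t) (a t) = velocity gamma t.

Definition Sq (vt : symfield) (gamma : R -> M) (t : R) : R :=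
  char_metric vt (gamma t) (velocity gamma t) (velocity gamma t).

(* D is the covariant derivative of vector fields along gamma induced by
   nabla; it is unique by these properties. *)
Record is_cov_along
    (nabla : (M -> 'rV[R]_n) -> (M -> 'rV[R]_n) -> M -> 'rV[R]_n)
    (I : set R) (gamma : R -> M)
    (D : (R -> 'rV[R]_n) -> R -> 'rV[R]_n) : Prop := {
  cov_smooth : forall V, smooth_vf_along I gamma V ->
    smooth_vf_along I gamma (D V);
  cov_add : forall V W t,
    smooth_vf_along I gamma V -> smooth_vf_along I gamma W -> I t ->
    D (fun s => V s + W s) t = D V t + D W t;
  cov_leibniz : forall (h : R -> R) V t,
    smooth_on I h -> smooth_vf_along I gamma V -> I t ->
    D (fun s => h s *: V s) t = derive1 h t *: V t + h t *: D V t;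
  cov_extend : forall X Y t, smooth_vf X -> smooth_vf Y -> I t ->
    X (gamma t) = velocity gamma t -> D (Y \o gamma) t = nabla X Y (gamma t)
}.

Definition geodesic
    (nabla : (M -> 'rV[R]_n) -> (M -> 'rV[R]_n) -> M -> 'rV[R]_n)
    (I : set R) (gamma : R -> M) : Prop :=
  smooth_curve I gamma /\
  exists2 D, is_cov_along nabla I gamma D &
    forall t, I t -> D (velocity gamma) t = 0.

End Manifold.

(* Main.v *)
(* In a chart let a_i be the components of the covector curve, T^ij those of vt
   and v^i = T^ij a_j those of the velocity.  Then Sq = a_i v^i is smooth, and
   differentiating v^i = T^ij a_j gives
     Sq' = 2 a_i (v^i)' - v^k (d_k T^ij) a_i a_j.
   By the geodesic equation the right-hand side is minus the value on (a, a) of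
   the covariant derivative of vt along v = vt(a), a multiple of [vt, vt]_s(a, a, a) = 0.

   The connection and the bracket act on global fields only, so the coordinate
   forms of the geodesic equation and of [vt, vt]_s = 0 are read off the fields
   E_i = rho d/dx^i, where rho is a bump function, and the decomposition
   2 rho^3 vt = sum_ij (rho T^ij) E_i (.) E_j. *)
From HB Require Import structures.
Require Import Defs.
From mathcomp Require Import all_boot all_order all_algebra.
From mathcomp Require Import all_classical all_reals all_analysis.
From mathcomp Require Import ring.

Set Implicit Arguments.
Unset Strict Implicit.
Unset Printing Implicit Defensive.

Import Order.TTheory GRing.Theory Num.Theory.
Import numFieldNormedType.Exports.
Local Open Scope classical_set_scope.
Local Open Scope ring_scope.

(** * Calculus of C^k maps *)

(** The rank of vt may change along the curve, so the characteristic metric cannot be expanded in a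
    smooth frame of im vt. The smooth covector curve takes the place of an inverse of vt: the value
    of the metric on vt(a), vt(a) is a(vt(a)) for every preimage a, whichever one is chosen.

    [Ck_on] speaks of directional derivatives only, which carry neither linearity in the direction
    nor a chain rule. Both are recovered by proving that a C^1 function in this sense is Fréchet
    differentiable, and every change of chart rests on that.

    Only the value of [vt, vt]_s on three equal covectors is needed. On equal covectors the shuffle
    product becomes, up to factorials, a product of numbers, and the derivation property of the
    bracket becomes a Leibniz rule between numbers, so that no bracket of multivector fields has to
    be computed in full. *)

Section DirectionalDerivatives.
Variable R : realType.
Implicit Types V W : normedModType R.

(** Restriction to a line turns directional derivatives into one-variable ones, for which
    derivability is differentiability and the mean value theorem is available. *)
Lemma derivable_line V W (f : V -> W) (y v : V) (s : R) :
  derivable (fun h : R => f (h *: v + y)) s 1 <-> derivable f (s *: v + y) v.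
Proof.
rewrite /derivable; set g1 := fun h => h^-1 *: _; set g2 := fun h => h^-1 *: _.
suff -> : g1 = g2 by [].
by rewrite funeqE /g1 /g2 => h /=; rewrite [_%:A]mulr1 scalerDl addrA.
Qed.

Lemma derive_line V W (f : V -> W) (y v : V) (s : R) :
  'D_1 (fun h : R => f (h *: v + y)) s = 'D_v f (s *: v + y).
Proof.
rewrite /derive; set g1 := fun h => h^-1 *: _; set g2 := fun h => h^-1 *: _.
suff -> : g1 = g2 by [].
by rewrite funeqE /g1 /g2 => h /=; rewrite [_%:A]mulr1 scalerDl addrA.
Qed.

(** The inner map need only have a derivative in the one direction [v]: its restriction to the line
    through [x] is differentiable, and the chain rule for differentials applies to that
    restriction. *)
Lemma is_derive_comp V W (W' : normedModType R) (f : V -> W) (g : W -> W') x v :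
  derivable f x v -> differentiable g (f x) ->
  is_derive x v (g \o f) ('d g (f x) ('D_v f x)).
Proof.
move=> dfx dg.
have e0 : (0 : R) *: v + x = x by rewrite scale0r add0r.
pose F := fun h : R => f (h *: v + x).
have dF : derivable F 0 1 by apply/derivable_line; rewrite e0.
have DF : 'D_1 F 0 = 'D_v f x by rewrite derive_line e0.
have F0 : F 0 = f x by rewrite /F e0.
have dF' : differentiable F (0 : R) by apply/derivable1_diffP.
have dgF : differentiable (g \o F) (0 : R).
  by apply: differentiable_comp => //; rewrite F0.
split.
  have := (derivable1_diffP (g \o F) 0).2 dgF.
  by move/(derivable_line (g \o f) x v 0); rewrite e0.
have := derive_line (g \o f) x v 0; rewrite e0 => <-.
transitivity ('D_1 (g \o F) 0) => //; rewrite deriveE// diff_comp//=.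
  by rewrite -(deriveE _ dF') DF F0.
by rewrite F0.
Qed.

(** Reparametrizing the line by [a * h] gives homogeneity in the direction without differentiability
    of [f], and includes [a = 0]. *)
Lemma is_derive_dirZ V W (f : V -> W) x v (a : R) :
  derivable f x v -> is_derive x (a *: v) f (a *: 'D_v f x).
Proof.
move=> dfx.
have e0 : (0 : R) *: v + x = x by rewrite scale0r add0r.
have e0a : (0 : R) *: (a *: v) + x = x by rewrite scale0r add0r.
pose F := fun h : R => f (h *: v + x).
have dF : differentiable F ((fun h : R => a * h) 0).
  by apply/derivable1_diffP/derivable_line; rewrite mulr0 e0.
have da : is_derive (0 : R) 1 (fun h : R => a * h) a.
  rewrite (_ : (fun h => _) = a *: id); last by apply/funext.
  by apply: is_derive_eq; rewrite [LHS]mulr1.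
have := @is_derive_comp _ _ _ (fun h : R => a * h) F 0 1 (ex_derive) dF.
rewrite (_ : F \o _ = fun h => f (h *: (a *: v) + x)); last first.
  by apply/funext => h; rewrite /F /= scalerA mulrC.
rewrite derive_val mulr0 => -[h1 h2]; split.
  by move/derivable_line: h1; rewrite e0a.
have := derive_line f x (a *: v) 0; rewrite e0a => <-; rewrite h2.
have dF0 : differentiable F (0 : R) by move: dF; rewrite mulr0.
by rewrite -[X in 'd _ _ X]mulr1 [LHS]linearZ -deriveE// derive_line e0.
Qed.

Lemma MVT_line V (f : V -> R) (y v : V) :
  (forall s : R, 0 <= s <= 1 -> derivable f (s *: v + y) v) ->
  exists2 c : R, 0 <= c <= 1 & f (v + y) - f y = 'D_v f (c *: v + y).
Proof.
move=> df; pose F := fun h : R => f (h *: v + y).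
have dF (s : R) : 0 <= s <= 1 -> is_derive s 1 F ('D_v f (s *: v + y)).
  by move=> /df ds; split; [exact/derivable_line | exact: derive_line].
have [||c] := @MVT_segment R F (fun s => 'D_v f (s *: v + y)) 0 1 ler01.
- move=> s; rewrite in_itv/= => /andP[s0 s1]; apply: dF.
  by rewrite !ltW.
- apply: derivable_within_continuous => s; rewrite in_itv/= => /dF ds.
  exact: ex_derive.
rewrite in_itv/= => c01; rewrite /F scale1r scale0r add0r subr0 mulr1 => ->.
by exists c.
Qed.

End DirectionalDerivatives.

(** * C^k maps: locality, algebraic operations, components *)

Section CkCalculus.
Variable R : realType.
Implicit Types (V W : normedModType R) (k : nat).

Lemma Ck_on_derivable V W k (U : set V) (f : V -> W) x v :
  Ck_on k.+1 U f -> U x -> derivable f x v.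
Proof. by case=> _ /(_ v)[df _] Ux; apply: df. Qed.

Lemma Ck_onW V W k (U : set V) (f : V -> W) : Ck_on k.+1 U f -> Ck_on k U f.
Proof.
elim: k f => [|k IH] f [cf df]; split=> // v.
by have [dfv Dfv] := df v; split=> //; apply: IH.
Qed.

Lemma Ck_on_leq V W k l (U : set V) (f : V -> W) :
  (k <= l)%N -> Ck_on l U f -> Ck_on k U f.
Proof.
move=> /subnKC <-; elim: (l - k)%N => [|d IH]; first by rewrite addn0.
by rewrite addnS => /Ck_onW.
Qed.

Lemma Ck_on_sub V W k (U U' : set V) (f : V -> W) :
  U `<=` U' -> Ck_on k U' f -> Ck_on k U f.
Proof.
move=> UU'; elim: k f => [|k IH] f [cf df].
  by split=> // x /UU'; apply: cf.
split=> [x /UU'|v]; first exact: cf.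
by have [dfv Dfv] := df v; split=> [x /UU'|]; [exact: dfv | exact: IH].
Qed.

(** All conditions in [Ck_on] are imposed at single points on the total functions [f], ['D_v f] and
    so on. Smoothness can therefore be checked around each point with a neighborhood and a formula
    of its own. *)
Lemma Ck_on_pointwise V W k (U : set V) (f : V -> W) :
  (forall x, U x -> Ck_on k [set x] f) -> Ck_on k U f.
Proof.
elim: k f => [|k IH] f Uf; split=> //.
- by move=> x /Uf[+ _]; apply.
- by move=> x /Uf[+ _]; apply.
- move=> v; split=> [x /Uf[_ /(_ v)[+ _]]|]; first exact.
  by apply: IH => x /Uf[_ /(_ v)[]].
Qed.

Lemma Ck_on_near V W k (U : set V) (f g : V -> W) :
  (forall x, U x -> \near x, f x = g x) -> Ck_on k U f -> Ck_on k U g.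
Proof.
elim: k f g => [|k IH] f g fg [cf df]; split=> //.
- move=> x Ux; have fgx := fg x Ux; rewrite /prop_for /continuous_at.
  rewrite -(nbhs_singleton fgx); apply: cvg_trans (cf x Ux).
  by apply: near_eq_cvg; apply: filterS fgx => y ->.
- move=> x Ux; have fgx := fg x Ux; rewrite /prop_for /continuous_at.
  rewrite -(nbhs_singleton fgx); apply: cvg_trans (cf x Ux).
  by apply: near_eq_cvg; apply: filterS fgx => y ->.
- move=> v; have [dfv Dfv] := df v; split.
    by move=> x Ux; apply: near_eq_derivable (dfv x Ux); apply: fg.
  (* Equality near [x] is equality near every [y] close to [x], so the derivatives agree near [x]
     and not only at [x]. *)
  apply: IH Dfv => x /fg /near_join; apply: filterS => y.
  exact: near_eq_derive.
Unshelve. all: by end_near. Qed.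

Lemma Ck_on_eq V W k (U : set V) (f g : V -> W) :
  open U -> (forall x, U x -> f x = g x) -> Ck_on k U f -> Ck_on k U g.
Proof.
move=> oU fg; apply: (@Ck_on_near _ _ _ _ f) => x Ux.
have : nbhs x U := open_nbhs_nbhs (conj oU Ux).
by apply: filterS => y /fg.
Qed.

Lemma Ck_on_cst V W k (U : set V) (w : W) : Ck_on k U (cst w : V -> W).
Proof.
elim: k w => [|k IH] w; split=> //; try by move=> x _; exact: cst_continuous.
move=> v; split=> [x _|]; first exact: derivable_cst.
rewrite (_ : (fun x => _) = cst 0); first exact: IH.
by apply/funext => x; rewrite derive_cst.
Qed.

Lemma Ck_on_id V k (U : set V) : Ck_on k U (id : V -> V).
Proof.
case: k => [|k]; split=> //; try by move=> x _; exact: cvg_id.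
move=> v; split=> [x _|]; first exact: derivable_id.
rewrite (_ : (fun x => _) = cst v); first exact: Ck_on_cst.
by apply/funext => x; rewrite derive_id.
Qed.

Lemma Ck_onD V W k (U : set V) (f g : V -> W) : open U ->
  Ck_on k U f -> Ck_on k U g -> Ck_on k U (fun x => f x + g x).
Proof.
move=> oU; elim: k f g => [|k IH] f g [cf df] [cg dg]; split=> //.
- by move=> x Ux; apply: cvgD; [exact: cf | exact: cg].
- by move=> x Ux; apply: cvgD; [exact: cf | exact: cg].
move=> v; have [dfv Dfv] := df v; have [dgv Dgv] := dg v; split.
  by move=> x Ux; apply: derivableD; [exact: dfv | exact: dgv].
apply: Ck_on_eq (IH _ _ Dfv Dgv) => // x Ux.
by rewrite deriveD//; [exact: dfv | exact: dgv].
Qed.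

Lemma Ck_on_sum V W k (U : set V) I (r : seq I) (f : I -> V -> W) : open U ->
  (forall i, Ck_on k U (f i)) -> Ck_on k U (fun x => \sum_(i <- r) f i x).
Proof.
move=> oU Uf; elim: r => [|i r IH].
  rewrite (_ : (fun x => _) = cst 0); first exact: Ck_on_cst.
  by apply/funext => x; rewrite big_nil.
rewrite (_ : (fun x => _) = (fun x => f i x + \sum_(j <- r) f j x)).
  exact: Ck_onD.
by apply/funext => x; rewrite big_cons.
Qed.

Lemma Ck_onM V k (U : set V) (f g : V -> R) : open U ->
  Ck_on k U f -> Ck_on k U g -> Ck_on k U (fun x => f x * g x).
Proof.
move=> oU; elim: k f g => [|k IH] f g Uf Ug.
  by split=> // x Ux; apply: cvgM; [exact: Uf.1 | exact: Ug.1].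
have [Uf' Ug'] := (Ck_onW Uf, Ck_onW Ug).
case: Uf Ug => [cf df] [cg dg]; split.
  by move=> x Ux; apply: cvgM; [exact: cf | exact: cg].
move=> v; have [dfv Dfv] := df v; have [dgv Dgv] := dg v; split.
  by move=> x Ux; apply: derivableM; [exact: dfv | exact: dgv].
apply: (@Ck_on_eq _ _ _ _ (fun x => f x * 'D_v g x + g x * 'D_v f x)) => //.
  by move=> x Ux; rewrite deriveM//; [exact: dfv | exact: dgv].
by apply: Ck_onD => //; apply: IH.
Qed.

Lemma Ck_onX V k (U : set V) (f : V -> R) p : open U ->
  Ck_on k U f -> Ck_on k U (fun x => f x ^+ p).
Proof.
move=> oU Uf; elim: p => [|p IH].
  rewrite (_ : (fun x => _) = cst 1); first exact: Ck_on_cst.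
  by apply/funext => x; rewrite expr0.
rewrite (_ : (fun x => _) = (fun x => f x * f x ^+ p)); first exact: Ck_onM.
by apply/funext => x; rewrite exprS.
Qed.

Lemma mx_continuous V m p (f : V -> 'M[R]_(m, p)) x :
  {for x, continuous f} <-> forall i j, {for x, continuous (fun y => f y i j)}.
Proof.
split=> [cf i j|cf].
  have := @continuous_comp _ _ _ f (fun M : 'M[R]_(m, p) => M i j) x cf.
  by apply; apply: coord_continuous.
apply/cvgrPdist_le => e e0; near=> y.
rewrite [leLHS]/Num.Def.normr/= mx_normrE (bigmax_le _ (ltW e0))//= => i _.
rewrite !mxE/=; move: i; near: y; apply: filter_forall => /= i.
by have /cvgrPdist_le := cf i.1 i.2; apply.
Unshelve. all: by end_near. Qed.

Lemma Ck_on_mx V m p k (U : set V) (f : V -> 'M[R]_(m, p)) : open U ->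
  Ck_on k U f <-> forall i j, Ck_on k U (fun x => f x i j).
Proof.
move=> oU; elim: k f => [|k IH] f.
  split=> [[cf _] i j|Uf]; split=> // x Ux.
    by have /mx_continuous := cf x Ux; apply.
  by apply/mx_continuous => i j; apply: (Uf i j).1.
split=> [[cf df] i j|Uf]; split.
- by move=> x Ux; have /mx_continuous := cf x Ux; apply.
- move=> v; have [dfv Dfv] := df v; split.
    by move=> x /dfv /derivable_mxP.
  have /IH/(_ i j) := Dfv; apply: Ck_on_eq => // x /dfv dfx.
  by rewrite derive_mx// mxE.
- by move=> x Ux; apply/mx_continuous => i j; apply: (Uf i j).1.
- move=> v; have dfv x : U x -> derivable f x v.
    by move=> Ux; apply/derivable_mxP => i j; apply: ((Uf i j).2 v).1.
  split=> //; apply/IH => i j.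
  apply: Ck_on_eq ((Uf i j).2 v).2 => // x /dfv dfx.
  by rewrite derive_mx// mxE.
Qed.

Lemma Ck_on_coord m p k (U : set 'M[R]_(m, p)) i j : open U ->
  Ck_on k U (fun A => A i j).
Proof. by move=> oU; move: i j; apply/Ck_on_mx => //; apply: Ck_on_id. Qed.

End CkCalculus.

(** * Fréchet differentiability of C^1 functions and the chain rule *)

Section ChainRule.
Variable R : realType.
Implicit Types (V W : normedModType R) (k n : nat).

(** The vertices of the path from 0 to [h] that moves along one coordinate axis at a time. *)
Definition row_prefix n (h : 'rV[R]_n) k : 'rV[R]_n :=
  \row_i (if (i < k)%N then h 0 i else 0).

Lemma row_prefixS n (h : 'rV[R]_n) (i : 'I_n) :
  row_prefix h i.+1 = h 0 i *: delta_mx 0 i + row_prefix h i.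
Proof.
apply/rowP => j; rewrite !mxE eqxx/= ltnS leq_eqVlt val_eqE.
by case: (eqVneq j i) => [->|_]; rewrite ?ltnn ?mulr1 ?mulr0 ?addr0 ?add0r.
Qed.

(** The norm is the maximum norm, so the whole coordinate path stays in the ball of radius [|h|],
    where the partial derivatives are under control. *)
Lemma norm_row_prefix n (h : 'rV[R]_n) (i : 'I_n) (s : R) : 0 <= s <= 1 ->
  `|s *: (h 0 i *: delta_mx 0 i) + row_prefix h i| <= `|h|.
Proof.
move=> /andP[s0 s1].
rewrite [leLHS]/Num.Def.normr/= mx_normrE (bigmax_le _ (normr_ge0 _))//=.
move=> [a j] _ /=; rewrite ord1 !mxE eqxx/=.
have hj : `|h 0 j| <= `|h|.
  rewrite [leRHS]/Num.Def.normr/= mx_normrE.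
  exact: (le_bigmax _ (fun ij : 'I_1 * 'I_n => `|h ij.1 ij.2|) (0, j)).
case: (eqVneq j i) => [<-|_]/=; rewrite ?ltnn ?mulr1 ?mulr0 ?addr0 ?add0r.
  by apply: le_trans hj; rewrite normrM ger0_norm// ler_piMl.
by case: ifP => // _; rewrite normr0.
Qed.

Lemma differentiable_near V W (f : V -> W) (df : {linear V -> W}) x :
  continuous df ->
  (forall e : R, 0 < e ->
    \forall h \near 0, `|f (h + x) - f x - df h| <= e * `|h|) ->
  differentiable f x /\ 'd f x = df :> (V -> W).
Proof.
move=> df_cont fdf.
have fo : f \o shift x = cst (f x) + df +o_ 0 id.
  apply/eqaddoP => e e0; near=> h.
  have -> : (f \o shift x - (cst (f x) + df)) h = f (h + x) - f x - df h.
    by rewrite -[LHS]/(f (h + x) - (f x + df h)) opprD addrA.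
  by near: h; exact: fdf.
have dE := diff_unique df_cont fo.
by split=> //; apply/diff_locallyP; rewrite dE.
Unshelve. all: by end_near. Qed.

(** The increment of [f] telescopes along the coordinate path. The mean value theorem turns each
    step into a partial derivative at a nearby point, and continuity of the partial derivatives
    bounds the error. *)
Lemma C1_differentiable n (U : set 'rV[R]_n) (f : 'rV[R]_n -> R) x :
  open U -> Ck_on 1 U f -> U x ->
  differentiable f x /\
  forall v, 'd f x v = \sum_i v 0 i * 'D_(delta_mx 0 i) f x.
Proof.
move=> oU Uf Ux.
pose c i := 'D_(delta_mx 0 i) f x.
pose L (v : 'rV[R]_n) := \sum_i v 0 i * c i.
have L_lin : linear L.
  move=> a u v; rewrite /L scaler_sumr -big_split /=; apply: eq_bigr => i _.
  by rewrite !mxE mulrDl -mulrA.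
pose LM := GRing.isLinear.Build _ _ _ _ _ L_lin.
pose LL : {linear 'rV[R]_n -> R} := HB.pack L LM.
have L_cont : continuous L.
  have : Ck_on 0 setT L.
    apply: Ck_on_sum => [|i]; first exact: openT.
    apply: Ck_onM; [exact: openT| |exact: Ck_on_cst].
    by apply: Ck_on_coord; exact: openT.
  by case=> + _ y; apply.
have := @differentiable_near _ _ f LL x L_cont.
case; last by move=> df dE; split=> // v; rewrite dE.
move=> _/posnumP[e].
(* Each of the [n] steps may err by this multiple of [|h|]; the denominator [n.+1] keeps the bound
   meaningful for [n = 0]. *)
have e'0 : 0 < e%:num / n.+1%:R by rewrite divr_gt0.
have : \forall y \near x, U y /\
    forall i, `|c i - 'D_(delta_mx 0 i) f y| <= e%:num / n.+1%:R.
  near=> y; split; first by near: y; exact: open_nbhs_nbhs (conj oU Ux).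
  near: y; apply: filter_forall => i.
  by have /cvgrPdist_le := (Uf.2 (delta_mx 0 i)).2.1 x Ux; apply.
move=> /nbhs_ballP[d /= d0 dP].
have dP' (h : 'rV[R]_n) : `|h| < d -> U (h + x) /\
    forall i, `|c i - 'D_(delta_mx 0 i) f (h + x)| <= e%:num / n.+1%:R.
  move=> hd; apply: dP; rewrite -ball_normE /ball_ /= opprD addrCA subrr addr0.
  by rewrite normrN.
have hd0 : \forall h \near (0 : 'rV[R]_n), `|h| < d by exact: nbhs0_lt.
apply: filterS hd0 => h hd.
rewrite -[X in `|_ - X|]/(L h).
have hn : row_prefix h n = h by apply/rowP => i; rewrite mxE ltn_ord.
have h0 : row_prefix h 0 = 0 by apply/rowP => i; rewrite !mxE.
have -> : f (h + x) - f x - L h =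
    \sum_(i < n) (f (row_prefix h i.+1 + x) - f (row_prefix h i + x)
                  - h 0 i * c i).
  by rewrite sumrB -(big_mkord xpredT (fun i => f (row_prefix h i.+1 + x)
    - f (row_prefix h i + x))) telescope_sumr// hn h0 add0r.
have step (i : 'I_n) : `|f (row_prefix h i.+1 + x) - f (row_prefix h i + x)
    - h 0 i * c i| <= `|h| * (e%:num / n.+1%:R).
  have xs (s : R) : 0 <= s <= 1 ->
      `|s *: (h 0 i *: delta_mx 0 i) + row_prefix h i| < d.
    by move=> s01; apply: le_lt_trans hd; exact: norm_row_prefix.
  have [|s s01] := @MVT_line _ _ f (row_prefix h i + x) (h 0 i *: delta_mx 0 i).
    move=> s s01; rewrite addrA; apply: Ck_on_derivable Uf _.
    by have [] := dP' _ (xs _ s01).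
  rewrite addrA -row_prefixS => ->; rewrite addrA.
  have [Uy cy] := dP' _ (xs _ s01).
  have [_ ->] := is_derive_dirZ (h 0 i)
    (Ck_on_derivable (v := delta_mx 0 i) Uf Uy).
  rewrite -mulrBr normrM distrC ler_pM//.
  rewrite [leRHS]/Num.Def.normr/= mx_normrE.
  exact: (le_bigmax _ (fun ij : 'I_1 * 'I_n => `|h ij.1 ij.2|) (0, i)).
apply: le_trans (ler_norm_sum _ _ _) _.
apply: le_trans (ler_sum _ (fun i _ => step i)) _.
rewrite sumr_const card_ord -[leLHS]mulr_natl mulrCA [leRHS]mulrC ler_wpM2l//.
rewrite mulrCA ger_pMr// ler_pdivrMr// mul1r ler_nat.
exact: leqnSn.
Unshelve. all: by end_near. Qed.

Lemma C1_is_derive_comp V n (U : set 'rV[R]_n) (f : V -> 'rV[R]_n)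
    (g : 'rV[R]_n -> R) x v :
  open U -> Ck_on 1 U g -> U (f x) -> derivable f x v ->
  is_derive x v (g \o f)
    (\sum_i ('D_v f x) 0 i * 'D_(delta_mx 0 i) g (f x)).
Proof.
move=> oU Ug Ufx dfx; have [dg dE] := C1_differentiable oU Ug Ufx.
by rewrite -dE; apply: is_derive_comp.
Qed.

Lemma C1_derive_dir n (U : set 'rV[R]_n) (f : 'rV[R]_n -> R) x v :
  open U -> Ck_on 1 U f -> U x ->
  'D_v f x = \sum_i v 0 i * 'D_(delta_mx 0 i) f x.
Proof.
move=> oU Uf Ux; have [df <-] := C1_differentiable oU Uf Ux.
exact: deriveE.
Qed.

(** In the chain rule formula the derivatives of [f] and the partial derivatives of [g] are of class
    C^k when [f] and [g] are of class C^(k+1), so induction applies to the partial derivatives of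
    [g] composed with the same [f]. *)
Lemma Ck_on_comp V n k (U : set V) (U' : set 'rV[R]_n) (f : V -> 'rV[R]_n)
    (g : 'rV[R]_n -> R) :
  open U -> open U' -> (forall x, U x -> U' (f x)) ->
  Ck_on k U f -> Ck_on k U' g -> Ck_on k U (g \o f).
Proof.
move=> oU oU' UU'; elim: k g => [|k IH] g Uf Ug.
  split=> // x Ux; apply: continuous_comp; first exact: Uf.1.
  by apply: Ug.1; exact: UU'.
have Ug1 := Ck_on_leq (ltn0Sn k) Ug.
have dgf x v : U x -> is_derive x v (g \o f)
    (\sum_i ('D_v f x) 0 i * 'D_(delta_mx 0 i) g (f x)).
  move=> Ux; apply: C1_is_derive_comp oU' Ug1 (UU' _ Ux) _.
  exact: Ck_on_derivable Uf Ux.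
split=> [x Ux|v].
  apply: continuous_comp; first exact: Uf.1.
  by apply: Ug.1; exact: UU'.
split=> [x /dgf dgfx|]; first exact: ex_derive.
apply: (@Ck_on_eq _ _ _ _ _
  (fun x => \sum_i ('D_v f x) 0 i * 'D_(delta_mx 0 i) g (f x))) => //.
  by move=> x /dgf dgfx; rewrite derive_val.
apply: Ck_on_sum => // i; apply: Ck_onM => //.
  exact: (Ck_on_mx _ _ oU).1 (Uf.2 v).2 0 i.
apply: (IH (fun y => 'D_(delta_mx 0 i) g y)); first exact: Ck_onW.
exact: (Ug.2 _).2.
Qed.

End ChainRule.

(** * A smooth function supported in a half-line *)

Section FlatFunction.
Variable R : realType.

(** The powers of 1/t make the family closed under differentiation up to linear combinations, which
    is what an induction on the order of differentiability needs. *)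
Definition flat (p : nat) (t : R) : R :=
  if 0 < t then t^-1 ^+ p * expR (- t^-1) else 0.

Lemma flat_gt0 p t : 0 < t -> 0 < flat p t.
Proof.
by move=> t0; rewrite /flat t0 mulr_gt0// ?expR_gt0// exprn_gt0// invr_gt0.
Qed.

Lemma flat_le0 p t : t <= 0 -> flat p t = 0.
Proof. by rewrite /flat leNgt => /negbTE ->. Qed.

Lemma flat_ge0 p t : 0 <= flat p t.
Proof. by case: (ltP 0 t) => [/(flat_gt0 p)/ltW|/(flat_le0 p) ->]. Qed.

(** With u = 1/t this is u^(p+1) / (p+1)! <= exp u, a single term of the exponential series. The
    extra power of u is what yields the factor [|t|], hence the limit 0 at the origin. *)
Lemma flat_le p t : `|flat p t| <= p.+1`!%:R * `|t|.
Proof.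
rewrite ger0_norm ?flat_ge0//; case: (ltP 0 t) => [t0|/(flat_le0 p) ->]; last first.
  by rewrite mulr_ge0.
have u0 : 0 < t^-1 by rewrite invr_gt0.
rewrite /flat t0 (gtr0_norm t0); set u := t^-1 in u0 *.
have tE : t = u^-1 by rewrite invrK.
rewrite expRN ler_pdivrMr ?expR_gt0//.
have : u ^+ p.+1 / p.+1`!%:R <= expR u.
  by apply: le_trans (expR_ge1Dxn p (ltW u0)); rewrite ler_wpDl.
rewrite ler_pdivrMr ?ltr0n ?fact_gt0// => h.
rewrite mulrAC tE.
by rewrite ler_pdivlMr// -exprSr mulrC.
Qed.

Lemma flat_cvg0 p : flat p t @[t --> (0 : R)] --> (0 : R).
Proof.
apply/cvgr0Pnorm_le => e e0.
have f0 : (0 : R) < p.+1`!%:R by rewrite ltr0n fact_gt0.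
have : \forall t \near (0 : R), `|t| <= e / p.+1`!%:R.
  by apply: nbhs0_le; rewrite divr_gt0.
apply: filterS => t te; apply: le_trans (flat_le p t) _.
by rewrite mulrC -ler_pdivlMr.
Qed.

Lemma is_derive_flat p (t : R) :
  is_derive t 1 (flat p) (flat p.+2 t - p%:R * flat p.+1 t).
Proof.
case: (ltrgtP t 0) => [t0|t0|->].
- rewrite !flat_le0 ?(ltW t0)// mulr0 subr0.
  have : is_derive t (1 : R) (cst 0 : R -> R) 0 by exact: is_derive_cst.
  apply: near_eq_is_derive.
  by apply: filterS (lt_nbhsl t0) => s /ltW /(flat_le0 p) ->.
- have t1 : t != 0 by rewrite gt_eqF.
  have dV : is_derive t (1 : R) (fun s : R => s^-1) (- t^-1 ^+ 2).
    split; first by apply: derivableV.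
    by rewrite deriveV// derive_id exprVn [LHS]mulr1.
  have dE : is_derive t (1 : R) (fun s : R => expR (- s^-1))
      (expR (- t^-1) * (t^-1 ^+ 2)).
    have dN : is_derive t (1 : R) (fun s : R => - s^-1) (t^-1 ^+ 2).
      by apply: is_derive_eq (is_deriveN dV) _; rewrite opprK.
    exact: (@is_derive1_comp _ expR (fun s : R => - s^-1)).
  have dX := is_deriveX p dV.
  have := is_deriveM dX dE; set D := (D in is_derive _ _ _ D) => dXE.
  suff <- : D = flat p.+2 t - p%:R * flat p.+1 t.
    apply: near_eq_is_derive dXE.
    by apply: filterS (lt_nbhsr t0) => s s0; rewrite /flat s0 exprfctE.
  rewrite /D /flat t0 exprfctE /GRing.scale/=; move: (t^-1) => u.
  have alg q (E : R) : u ^+ q.+1 * (E * u ^+ 2) +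
      E * (q.+1%:R * u ^+ q * - u ^+ 2) =
      u ^+ q.+3 * E - q.+1%:R * (u ^+ q.+2 * E) by rewrite !exprS; ring.
  (* The derivative of a power has the truncated exponent [p.-1], so [p = 0] is separate. *)
  by case: (p) => [|q] /=; [rewrite expr0; ring | exact: alg].
(* At the origin the difference quotient of [flat p] is [flat p.+1], which tends to 0. *)
- rewrite !flat_le0// mulr0 subr0.
  have : h^-1 *: ((flat p \o shift 0) (h *: (1 : R)) - flat p 0) @[h --> 0^'] -->
      (0 : R).
    have := cvg_within_filter _ (@flat_cvg0 p.+1); move=> /(_ _ [set h : R | h != 0]).
    apply: cvg_trans; apply: near_eq_cvg; near=> h.
    rewrite /= [h%:A]mulr1 addr0 (@flat_le0 p 0)// subr0.
    case: (ltP 0 h) => [hp|hn]; last by rewrite !flat_le0// scaler0.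
    by rewrite /flat hp /GRing.scale/= exprS mulrA.
  move=> dflat; split; last exact: cvg_lim.
  by apply/cvg_ex; exists 0.
Unshelve. all: by end_near. Qed.

Lemma Ck_on_flat_comp (V : normedModType R) (U : set V) (q : V -> R) k p :
  open U -> Ck_on k U q -> Ck_on k U (fun x => flat p (q x)).
Proof.
move=> oU; elim: k p q => [|k IH] p q Uq.
  split=> // x Ux; apply: (continuous_comp (Uq.1 x Ux)).
  by apply/differentiable_continuous/derivable1_diffP; have [] := is_derive_flat p (q x).
have dq x v : U x -> is_derive x v (fun x => flat p (q x))
    ('D_v q x * (flat p.+2 (q x) - p%:R * flat p.+1 (q x))).
  move=> Ux; have dqx : derivable q x v := Ck_on_derivable Uq Ux.
  have [dfl Dfl] := is_derive_flat p (q x).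
  have dfl' : differentiable (flat p) (q x) by apply/derivable1_diffP.
  apply: is_derive_eq (is_derive_comp dqx dfl') _.
  by rewrite -[X in 'd _ _ X]mulr1 [LHS]linearZ -Dfl (deriveE _ dfl').
split=> [x Ux|v].
  apply: (continuous_comp (Uq.1 x Ux)).
  by apply/differentiable_continuous/derivable1_diffP; have [] := is_derive_flat p (q x).
split=> [x Ux|]; first by have [] := dq x v Ux.
apply: (@Ck_on_eq _ _ _ _ _
    (fun x => 'D_v q x * (flat p.+2 (q x) + (- p%:R) * flat p.+1 (q x)))) => //.
  by move=> x /dq dqx; rewrite derive_val mulNr.
apply: Ck_onM => //; first exact: (Uq.2 v).2.
apply: Ck_onD => //; first exact/IH/Ck_onW.
by apply: Ck_onM => //; [exact: Ck_on_cst | exact/IH/Ck_onW].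
Qed.

End FlatFunction.

(** * Calculus in charts *)

Section ManifoldCalculus.
Variables (R : realType) (n : nat) (M : smooth_manifold R n).
Implicit Types (c : chart R n M) (m : M) (v : 'rV[R]_n).

Lemma cinvP c x : cimg c x -> cdom c (cinv c x) /\ cmap c (cinv c x) = x.
Proof. by move=> [m cm <-]; rewrite cmapK. Qed.

Lemma cimg_cmap c m : cdom c m -> cimg c (cmap c m).
Proof. by move=> cm; exists m. Qed.

Lemma open_chart_image c (A : set M) : open A ->
  open (cmap c @` (cdom c `&` A)).
Proof.
move=> oA; rewrite openE => _ [m [cm Am] <-].
have cix := cimg_cmap cm.
have Nx : nbhs (cmap c m) (cimg c) := open_nbhs_nbhs (conj (@cimg_open _ _ _ c) cix).
have NA : nbhs (cmap c m) (cinv c @^-1` A).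
  apply: (cinv_continuous cix); rewrite cmapK//.
  exact: open_nbhs_nbhs (conj oA Am).
rewrite /interior; near=> x.
have [cx xE] : cdom c (cinv c x) /\ cmap c (cinv c x) = x.
  by apply: cinvP; near: x.
by exists (cinv c x) => //; split=> //; near: x.
Unshelve. all: by end_near. Qed.

Lemma chart_at_atlas m : atlas M (chart_at m).
Proof. by rewrite /chart_at; case: (cid2 _). Qed.

Lemma chart_at_dom m : cdom (chart_at m) m.
Proof. by rewrite /chart_at; case: (cid2 _). Qed.

(** The differential of a transition map. Both [tcoord] and [coord_vec] are instances, with
    [chart_at m] as source or as target. *)
Definition jac c c' m v : 'rV[R]_n := 'D_v (cmap c' \o cinv c) (cmap c m).

Lemma transition_C1 c c' : atlas M c -> atlas M c' ->
  Ck_on 1 (cmap c @` (cdom c `&` cdom c')) (cmap c' \o cinv c).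
Proof. by move=> ac ac'; exact: atlas_smooth. Qed.

Lemma open_overlap c c' : open (cmap c @` (cdom c `&` cdom c')).
Proof. exact: open_chart_image (@cdom_open _ _ _ c'). Qed.

Lemma C1_is_derive_comp_rV (V : normedModType R) p q (U : set 'rV[R]_p)
    (f : V -> 'rV[R]_p) (g : 'rV[R]_p -> 'rV[R]_q) x (v : V) :
  open U -> Ck_on 1 U g -> U (f x) -> derivable f x v ->
  is_derive x v (g \o f) ('D_('D_v f x) g (f x)).
Proof.
move=> oU Ug Ufx dfx.
have Ug' j : Ck_on 1 U (fun y => g y 0 j) := (Ck_on_mx _ _ oU).1 Ug 0 j.
have dj j := C1_is_derive_comp oU (Ug' j) Ufx dfx.
have dgf : derivable (g \o f) x v.
  by apply/derivable_mxP => i j; rewrite ord1; have [] := dj j.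
split=> //; rewrite derive_mx//; apply/rowP => j; rewrite !mxE.
have [_ ->] := dj j; rewrite -(C1_derive_dir _ oU (Ug' j) Ufx).
by rewrite (derive_mx (Ck_on_derivable (v := 'D_v f x) Ug Ufx)) mxE.
Qed.

(** Stated for a map from any normed space so as to serve twice: a curve gives the transformation of
    velocities, and [cinv c] gives the cocycle identity [jac_comp]. *)
Lemma is_derive_chart_change (V : normedModType R) (f : V -> M) c c' x (v : V) :
  atlas M c -> atlas M c' -> cdom c (f x) -> cdom c' (f x) ->
  {for x, continuous f} -> derivable (cmap c \o f) x v ->
  is_derive x v (cmap c' \o f) (jac c c' (f x) ('D_v (cmap c \o f) x)).
Proof.
move=> ac ac' cx c'x cf df.
have Ux : (cmap c @` (cdom c `&` cdom c')) ((cmap c \o f) x) by exists (f x).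
have := C1_is_derive_comp_rV (@open_overlap c c') (transition_C1 ac ac') Ux df.
apply: near_eq_is_derive.
have : \forall y \near x, cdom c (f y).
  by apply: cf; exact: open_nbhs_nbhs (conj (@cdom_open _ _ _ c) cx).
by apply: filterS => y cy /=; rewrite cmapK.
Qed.

Lemma jac_id c m v : cdom c m -> jac c c m v = v.
Proof.
move=> cm; rewrite /jac -[RHS](derive_id (cmap c m) v); apply: near_eq_derive.
have : nbhs (cmap c m) (cimg c).
  exact: open_nbhs_nbhs (conj (@cimg_open _ _ _ c) (cimg_cmap cm)).
by apply: filterS => x /cinvP[].
Qed.

Lemma transition_derivable c c' m v : atlas M c -> atlas M c' ->
  cdom c m -> cdom c' m -> derivable (cmap c' \o cinv c) (cmap c m) v.
Proof.
by move=> ac ac' cm c'm; apply: Ck_on_derivable (transition_C1 ac ac') _; exists m.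
Qed.

Lemma jac_comp c c' c'' m v : atlas M c -> atlas M c' -> atlas M c'' ->
  cdom c m -> cdom c' m -> cdom c'' m ->
  jac c' c'' m (jac c c' m v) = jac c c'' m v.
Proof.
move=> ac ac' ac'' cm c'm c''m.
have := @is_derive_chart_change _ (cinv c) c' c'' (cmap c m) v ac' ac''.
rewrite cmapK// => /(_ c'm c''m (cinv_continuous (cimg_cmap cm))).
by move=> /(_ (transition_derivable ac ac' cm c'm))[_ /esym].
Qed.

Lemma jacE c c' m v : atlas M c -> atlas M c' -> cdom c m -> cdom c' m ->
  jac c c' m v = \sum_i v 0 i *: jac c c' m (delta_mx 0 i).
Proof.
move=> ac ac' cm c'm; apply/rowP => j.
have Ux : (cmap c @` (cdom c `&` cdom c')) (cmap c m) by exists m.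
have UC := transition_C1 ac ac'.
have oU := @open_overlap c c'.
have jacj w : jac c c' m w 0 j =
    'D_w (fun x => (cmap c' \o cinv c) x 0 j) (cmap c m).
  by rewrite /jac (derive_mx (Ck_on_derivable (v := w) UC Ux)) mxE.
rewrite jacj (C1_derive_dir _ oU _ Ux); last exact: (Ck_on_mx _ _ oU).1 UC 0 j.
by rewrite summxE; apply: eq_bigr => i _; rewrite mxE jacj.
Qed.

Lemma tcoordE c m v : tcoord c m v = jac (chart_at m) c m v.
Proof. by []. Qed.

Lemma coord_vecE c m i : coord_vec c m i = jac c (chart_at m) m (delta_mx 0 i).
Proof. by []. Qed.

Section AtPoint.
Variables (c : chart R n M) (m : M).
Hypotheses (ac : atlas M c) (cm : cdom c m).
Let at_ := chart_at_atlas m.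
Let dom_ := chart_at_dom m.

Lemma tcoord_linear (a : R) u v :
  tcoord c m (a *: u + v) = a *: tcoord c m u + tcoord c m v.
Proof.
rewrite !tcoordE (jacE (a *: u + v))// (jacE u)// (jacE v)//.
rewrite scaler_sumr -big_split/=; apply: eq_bigr => i _.
by rewrite !mxE scalerDl scalerA.
Qed.

Lemma tcoord0 : tcoord c m 0 = 0.
Proof. exact: derive0. Qed.

Lemma tcoordZ (a : R) v : tcoord c m (a *: v) = a *: tcoord c m v.
Proof. by have := tcoord_linear a v 0; rewrite tcoord0 !addr0. Qed.

Lemma tcoordK v : v = \sum_i tcoord c m v 0 i *: coord_vec c m i.
Proof.
rewrite -{1}[v](jac_id v dom_) -(@jac_comp _ c)//.
by rewrite (jacE (jac (chart_at m) c m v)).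
Qed.

Lemma pairing_sum a (s : seq 'I_n) (F : 'I_n -> 'rV[R]_n) :
  pairing a (\sum_(i <- s) F i) = \sum_(i <- s) pairing a (F i).
Proof. by rewrite /pairing mulmx_suml summxE. Qed.

Lemma pairing_coord_covec i v : pairing (coord_covec c m i) v = tcoord c m v 0 i.
Proof.
rewrite /pairing mxE tcoordE (jacE v)// summxE.
by apply: eq_bigr => j _; rewrite !mxE.
Qed.

End AtPoint.

End ManifoldCalculus.

(** * Symmetric forms and the characteristic metric *)

Section SymmetricForms.
Variables (R : realType) (n : nat) (M : smooth_manifold R n).
Implicit Types (P vt : symfield M) (m : M) (alpha beta : 'cV[R]_n).

Lemma symf0 P m s : is_symfield P -> P m (0 :: s) = 0.
Proof.
(* With coefficient -1 and two zero covectors, linearity makes the value at 0 equal to minus itself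
   plus itself. *)
move=> sP; have := symf_linear sP m (-1) 0 0 s.
by rewrite scaler0 addr0 mulN1r addNr.
Qed.

Lemma symf_suml P m s I (r : seq I) (a : I -> R) (alpha : I -> 'cV[R]_n) :
  is_symfield P ->
  P m (\sum_(i <- r) a i *: alpha i :: s) = \sum_(i <- r) a i * P m (alpha i :: s).
Proof.
move=> sP; elim: r => [|i r IH]; first by rewrite !big_nil symf0.
by rewrite !big_cons symf_linear// IH.
Qed.

Lemma symf2C P m alpha beta : is_symfield P ->
  P m [:: alpha; beta] = P m [:: beta; alpha].
Proof.
by move=> sP; apply: (symf_sym sP); apply/permPl/(perm_catC [:: _] [:: _]).
Qed.

Lemma col_sum_delta alpha : alpha = \sum_i alpha i 0 *: delta_mx i 0.
Proof.
by rewrite {1}[alpha]matrix_sum_delta; apply: eq_bigr => i _; rewrite big_ord1.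
Qed.

Lemma pairing_sharp vt m alpha beta : is_symfield vt ->
  pairing beta (sharp vt m alpha) = vt m [:: alpha; beta].
Proof.
move=> svt; rewrite symf2C// {2}(col_sum_delta beta) symf_suml//.
rewrite /pairing mxE; apply: eq_bigr => i _.
by rewrite mxE mulrC symf2C.
Qed.

(** The metric may have been computed from other preimages [a], [b] of the same vectors. By symmetry
    [vt m [:: a; b]] depends on each argument only through its image under [sharp], so they can be
    exchanged one at a time. *)
Lemma char_metric_sharp vt m alpha beta : is_symfield vt ->
  char_metric vt m (sharp vt m alpha) (sharp vt m beta) = vt m [:: alpha; beta].
Proof.
move=> svt; rewrite /char_metric; case: xgetP => [x _ /= [a [b [sa sb ->]]]|].
  rewrite -pairing_sharp// sa pairing_sharp// symf2C//.
  by rewrite -pairing_sharp// sb pairing_sharp// symf2C.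
by move=> /(_ (vt m [:: alpha; beta])) []; exists alpha, beta.
Qed.

End SymmetricForms.

(** * Velocities and smoothness of the squared speed *)

Section Curves.
Variables (R : realType) (n : nat) (M : smooth_manifold R n).
Variables (I : set R) (gamma : R -> M).
Hypotheses (oI : open I) (sgamma : smooth_curve I gamma).
Implicit Types c : chart R n M.

Lemma open_curve_preimage (A : set M) : open A -> open (I `&` gamma @^-1` A).
Proof.
move=> oA; rewrite openE => t [It At]; rewrite /interior.
apply: filterI; first exact: open_nbhs_nbhs (conj oI It).
by apply: (sgamma.1 t It); exact: open_nbhs_nbhs (conj oA At).
Qed.

Lemma open_curve_dom c : open (I `&` gamma @^-1` cdom c).
Proof. exact: open_curve_preimage (@cdom_open _ _ _ c). Qed.

Lemma curve_derivable c t : atlas M c -> I t -> cdom c (gamma t) ->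
  derivable (cmap c \o gamma) t (1 : R).
Proof.
by move=> ac It ct; apply: Ck_on_derivable (sgamma.2 c ac 1%N) _; split.
Qed.

Lemma tcoord_velocity c t : atlas M c -> I t -> cdom c (gamma t) ->
  tcoord c (gamma t) (velocity gamma t) = 'D_1 (cmap c \o gamma) t.
Proof.
move=> ac It ct; rewrite /velocity derive1E tcoordE.
have ac0 := chart_at_atlas (gamma t); have dom0 := chart_at_dom (gamma t).
by have [_ ->] := is_derive_chart_change ac0 ac dom0 ct (sgamma.1 t It)
  (curve_derivable ac0 It dom0).
Qed.

Lemma smooth_velocity : smooth_vf_along I gamma (velocity gamma).
Proof.
move=> c ac k; apply: (@Ck_on_eq _ _ _ _ _ (fun t => 'D_1 (cmap c \o gamma) t)).
- exact: open_curve_dom.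
- by move=> t [It ct]; rewrite tcoord_velocity.
- exact: ((sgamma.2 c ac k.+1).2 1).2.
Qed.

Lemma smooth_velocity_coord c i k : atlas M c ->
  Ck_on k (I `&` gamma @^-1` cdom c)
    (fun t => tcoord c (gamma t) (velocity gamma t) 0 i).
Proof.
move=> ac; exact: (Ck_on_mx _ _ (@open_curve_dom c)).1 (smooth_velocity ac k) 0 i.
Qed.

Lemma pairing_tcoord c m alpha v : atlas M c -> cdom c m ->
  pairing alpha v = \sum_i pairing alpha (coord_vec c m i) * tcoord c m v 0 i.
Proof.
move=> ac cm; rewrite {1}(tcoordK ac cm v) pairing_sum; apply: eq_bigr => i _.
by rewrite /pairing -scalemxAl mxE mulrC.
Qed.

Lemma Sq_pairing vt a t : is_symfield vt ->
  sharp vt (gamma t) (a t) = velocity gamma t ->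
  Sq vt gamma t = pairing (a t) (velocity gamma t).
Proof.
by move=> svt at_; rewrite /Sq -at_ char_metric_sharp// pairing_sharp.
Qed.

Lemma Sq_coord vt a c t : is_symfield vt ->
  sharp vt (gamma t) (a t) = velocity gamma t -> atlas M c -> cdom c (gamma t) ->
  Sq vt gamma t = \sum_i pairing (a t) (coord_vec c (gamma t) i) *
                         tcoord c (gamma t) (velocity gamma t) 0 i.
Proof. by move=> svt at_ ac ct; rewrite (Sq_pairing svt at_) -pairing_tcoord. Qed.

Lemma smooth_Sq vt a : is_symfield vt -> smooth_cf_along I gamma a ->
  (forall t, I t -> sharp vt (gamma t) (a t) = velocity gamma t) ->
  smooth_on I (Sq vt gamma).
Proof.
move=> svt sa va k; apply: Ck_on_pointwise => t It.
pose c := chart_at (gamma t); have ac : atlas M c := chart_at_atlas _.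
have oU := @open_curve_dom c.
apply: (@Ck_on_sub _ _ _ _ _ (I `&` gamma @^-1` cdom c)).
  by move=> _ ->; split=> //; exact: chart_at_dom.
apply: (@Ck_on_eq _ _ _ _ _ (fun t =>
    \sum_i pairing (a t) (coord_vec c (gamma t) i) *
           tcoord c (gamma t) (velocity gamma t) 0 i)) => //.
  by move=> s [Is cs]; rewrite -(Sq_coord svt (va s Is) ac cs).
apply: Ck_on_sum => // i; apply: Ck_onM => //; first exact: sa.
exact: smooth_velocity_coord.
Qed.

End Curves.

(** * Extension by zero and bump functions *)

Section Extension.
Variables (R : realType) (n : nat) (M : smooth_manifold R n).
Implicit Types c : chart R n M.

Lemma Ck_on_chart_change c c' (A : set M) (F : M -> R) k :
  atlas M c -> atlas M c' -> open A ->
  Ck_on k (cmap c @` (cdom c `&` A)) (F \o cinv c) ->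
  Ck_on k (cmap c' @` (cdom c' `&` (cdom c `&` A))) (F \o cinv c').
Proof.
move=> ac ac' oA UF.
have oU := @open_chart_image _ _ _ c' _ (openI (@cdom_open _ _ _ c) oA).
apply: (@Ck_on_eq _ _ _ _ _ ((F \o cinv c) \o (cmap c \o cinv c'))) => //.
  by move=> _ [m [c'm [cm _]] <-] /=; rewrite !cmapK.
apply: Ck_on_comp (@open_chart_image _ _ _ c _ oA) _ _ UF => //.
  by move=> _ [m [c'm [cm Am]] <-] /=; rewrite !cmapK//; exists m.
apply: Ck_on_sub (atlas_smooth ac' ac k).
by move=> _ [m [c'm [cm _]] <-]; exists m.
Qed.

(** A point outside the domain of [c] lies in the open complement of [K], so [F] vanishes near it;
    at the other points smoothness is carried over from [c] by the transition map. *)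
Lemma Ck_on_supp c c' (K : set M) (F : M -> R) k :
  atlas M c -> atlas M c' -> closed K -> K `<=` cdom c ->
  (forall m, ~ K m -> F m = 0) ->
  Ck_on k (cmap c @` (cdom c `&` cdom c')) (F \o cinv c) ->
  Ck_on k (cimg c') (F \o cinv c').
Proof.
move=> ac ac' clK Kc F0 UF; apply: Ck_on_pointwise => _ [m c'm <-].
have [cm|ncm] := pselect (cdom c m).
  apply: Ck_on_sub (Ck_on_chart_change ac ac' (@cdom_open _ _ _ c') UF).
  by move=> _ ->; exists m.
apply: (@Ck_on_near _ _ _ _ _ (cst 0)); last exact: Ck_on_cst.
move=> _ ->.
have : \forall x \near cmap c' m, (~` K) (cinv c' x).
  apply: (cinv_continuous (cimg_cmap c'm)); rewrite cmapK//.
  by apply: open_nbhs_nbhs; split; [rewrite openC | move=> /Kc].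
by apply: filterS => x /F0 /= ->.
Qed.

(* As the differential of rho vanishes at m0, rho behaves there like a constant
   in every first-order formula, so that rho need not be constant near m0. *)
Record is_bump c (m0 : M) (K : set M) (rho : M -> R) : Prop := {
  bump_closed : closed K;
  bump_dom : K `<=` cdom c;
  bump_supp : forall m, ~ K m -> rho m = 0;
  bump_smooth : smooth_on (cimg c) (rho \o cinv c);
  bump_neq0 : rho m0 != 0;
  bump_flat : forall v, 'D_v (rho \o cinv c) (cmap c m0) = 0
}.

Lemma ex_bump c m0 : cdom c m0 -> exists K rho, is_bump c m0 K rho.
Proof.
move=> cm0; set x0 := cmap c m0.
have : nbhs x0 (cimg c).
  exact: open_nbhs_nbhs (conj (@cimg_open _ _ _ c) (cimg_cmap cm0)).
move=> /nbhs_closedballP[r Br].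
(* The norm on row vectors is the maximum norm, which is not smooth; the Euclidean square is, and
   its ball of radius [r] lies inside the maximum-norm ball. *)
pose q (x : 'rV[R]_n) := r%:num ^+ 2 - \sum_i (x 0 i - x0 0 i) ^+ 2.
have q_smooth k : Ck_on k setT q.
  have oT : open (@setT 'rV[R]_n) by exact: openT.
  apply: (@Ck_on_eq _ _ _ _ _
    (fun x : 'rV[R]_n => r%:num ^+ 2 + \sum_i -1 * (x 0 i + - x0 0 i) ^+ 2)) => //.
    by move=> x _; rewrite /q -sumrN; under eq_bigr do rewrite mulN1r.
  apply: Ck_onD => //; first exact: Ck_on_cst.
  apply: Ck_on_sum => // i; apply: Ck_onM => //; first exact: Ck_on_cst.
  apply: Ck_onX => //; apply: Ck_onD => //; last exact: Ck_on_cst.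
  exact: Ck_on_coord.
have q_ball x : 0 < q x -> closed_ball x0 r%:num x.
  rewrite subr_gt0 => qx; rewrite closed_ballE// /closed_ball_/=.
  rewrite [leLHS]/Num.Def.normr/= mx_normrE bigmax_le// => -[i j] _ /=.
  rewrite ord1 !mxE -[leRHS]ger0_norm// -ler_sqr ?nnegrE// !real_normK ?num_real//.
  apply: le_trans (ltW qx); rewrite -sqrrN opprB (bigD1 j)//= lerDl.
  by apply: sumr_ge0 => ? _; exact: sqr_ge0.
exists (cinv c @` closed_ball x0 r%:num).
exists (fun m => if `[< cdom c m >] then flat 0 (q (cmap c m)) else 0); split.
(* The support must be closed in all of [M], not merely in the chart domain: it is the image of a
   compact ball, and [M] is Hausdorff. *)
- apply: compact_closed; first exact: m_hausdorff.
  apply: continuous_compact.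
    apply/continuous_in_subspaceT => x /[1!inE] /Br.
    exact: cinv_continuous.
  apply: bounded_closed_compact; last exact: closed_ball_closed.
  exists (`|x0| + r%:num); split; first exact: num_real.
  move=> b x0b x; rewrite closed_ballE// /closed_ball_/= => xr.
  apply: le_trans (ltW x0b); rewrite -[x](subKr x0).
  by apply: le_trans (ler_normB _ _) _; rewrite lerD2l.
- by move=> _ [x /Br /cinvP[cx _] <-].
- move=> m nKm; case: asboolP => // cm; apply: flat_le0; rewrite leNgt.
  apply/negP => /q_ball qm; apply: nKm; exists (cmap c m) => //.
  exact: cmapK.
- move=> k; apply: (@Ck_on_eq _ _ _ _ _ (fun x => flat 0 (q x))).
  + exact: cimg_open.
  + by move=> x /cinvP[cx xE] /=; rewrite asboolT// xE.
  + apply: Ck_on_flat_comp; first exact: cimg_open.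
    exact: Ck_on_sub (q_smooth k).
- rewrite asboolT// gt_eqF// flat_gt0// /q big1 ?subr0 ?exprn_gt0// => i _.
  by rewrite subrr expr0n.
- move=> v; transitivity ('D_v (fun x => flat 0 (q x)) x0).
    apply: near_eq_derive.
    have : nbhs x0 (cimg c).
      exact: open_nbhs_nbhs (conj (@cimg_open _ _ _ c) (cimg_cmap cm0)).
    by apply: filterS => x /cinvP[cx xE] /=; rewrite asboolT// xE.
  (* On the line through [x0] in direction [v], [q] is [r ^+ 2 - h ^+ 2 * S], which is critical at
     [h = 0]. *)
  pose S := \sum_i v 0 i ^+ 2.
  have x0E : (0 : R) *: v + x0 = x0 by rewrite scale0r add0r.
  have := derive_line (fun x => flat 0 (q x)) x0 v 0; rewrite x0E => <-.
  have qE (h : R) : q (h *: v + x0) = r%:num ^+ 2 - h ^+ 2 * S.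
    rewrite /q /S mulr_sumr; congr (_ - _); apply: eq_bigr => i _.
    by rewrite !mxE addrK exprMn.
  rewrite (_ : (fun h => _) =
      flat 0 \o (cst (r%:num ^+ 2) - (id ^+ 2) * cst S : R -> R)); last first.
    by apply/funext => h; rewrite qE exprfctE.
  have dg : is_derive (0 : R) (1 : R)
      (cst (r%:num ^+ 2) - (id ^+ 2) * cst S : R -> R) 0.
    apply: is_derive_eq.
    by rewrite scaler0 expr1 mulr0 scale0r scaler0 addr0 subr0.
  have := @is_derive1_comp _ (flat 0) _ 0 _ _ (is_derive_flat 0 _) dg.
  by rewrite mulr0 => -[_ ->].
Qed.

End Extension.

(** * Symmetric multivector fields and their bracket *)

Section SymmetricAlgebra.
Variables (R : realType) (n : nat) (M : smooth_manifold R n).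
Implicit Types (P Q : symfield M) (m : M) (f : M -> R) (X Y : M -> 'rV[R]_n).

Lemma sum_tupleS (N : nat) (F : N.+1.-tuple bool -> R) :
  \sum_b F b = \sum_(b : N.-tuple bool) F [tuple of true :: b] +
               \sum_(b : N.-tuple bool) F [tuple of false :: b].
Proof.
rewrite (reindex (fun p : bool * N.-tuple bool => [tuple of p.1 :: p.2])) /=.
  rewrite -(pair_big xpredT xpredT (fun x (b : N.-tuple bool) =>
    F [tuple of x :: b]))/=.
  by rewrite big_bool.
exists (fun b => (thead b, [tuple of behead b])) => [[x b] _|b _] /=.
  by congr (_, _); apply/val_inj.
by apply/val_inj; rewrite /= [in RHS](tuple_eta b).
Qed.

Lemma sum_tuple0 (F : 0.-tuple bool -> R) : \sum_b F b = F [tuple].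
Proof.
rewrite (bigD1 [tuple])//= big1 ?addr0// => b /eqP[].
by apply/val_inj; rewrite /= tuple0.
Qed.

(** Pascal's rule on the first bit. This is the number of shuffles contributing to a symmetric
    product of homogeneous fields. *)
Lemma sum_tuple_count N r :
  \sum_(b : N.-tuple bool) (count id b == r)%:R = 'C(N, r)%:R :> R.
Proof.
elim: N r => [|N IH] r; first by rewrite sum_tuple0 /= bin0n eq_sym.
rewrite sum_tupleS /=; under [X in _ + X]eq_bigr do rewrite add0n.
rewrite IH; case: r => [|r]; first by rewrite big1 ?add0r ?bin0.
by under eq_bigr do rewrite add1n eqSS; rewrite IH binS natrD addrC.
Qed.

Lemma sym_mul_size P Q m s N : size s = N ->
  sym_mul P Q m s = \sum_(b : N.-tuple bool)
    P m (mask b s) * Q m (mask [seq ~~ x | x <- b] s).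
Proof. by move=> <-. Qed.

Lemma count_negb (b : seq bool) :
  (count id b + count id [seq ~~ x | x <- b])%N = size b.
Proof. by rewrite count_map -(count_predC id b). Qed.

Lemma homogeneous_mul r q P Q : homogeneous r P -> homogeneous q Q ->
  homogeneous (r + q) (sym_mul P Q).
Proof.
move=> hP hQ m s srq; rewrite /sym_mul big1// => b _.
have sb : size b = size s by rewrite size_tuple.
have [br|/eqP br] := eqVneq (size (mask b s)) r; last by rewrite hP ?mul0r.
rewrite hQ ?mulr0// => bq; apply: srq; rewrite -br -bq.
by rewrite !size_mask ?size_map// count_negb.
Qed.

Lemma mask_nseq (b : seq bool) k (a : 'cV[R]_n) : size b = k ->
  mask b (nseq k a) = nseq (count id b) a.
Proof. by elim: b k => [|[] b IH] [|k]//= [/IH ->]. Qed.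

Lemma homogeneous_fun f : homogeneous 0 (sym_of_fun f).
Proof. by move=> m [|x s]. Qed.

Lemma homogeneous_vf X : homogeneous 1 (sym_of_vf X).
Proof. by move=> m [|x [|y s]]. Qed.

Lemma is_symfield_fun f : smooth_fun f -> is_symfield (sym_of_fun f).
Proof.
move=> sf; split.
- by move=> m [|x s] [|y s'] // /perm_size.
- by move=> *; rewrite mulr0 addr0.
- by exists 0%N => m [].
- move=> c [|i s] ac k /=; first exact: sf.
  exact: (@Ck_on_cst _ _ _ _ _ (0 : R)).
Qed.

Lemma is_symfield_vf X : smooth_vf X -> is_symfield (sym_of_vf X).
Proof.
move=> sX; split.
- move=> m [|x [|y s]] [|x' [|y' s']] // /[dup] /perm_size // _.
  by move=> /perm_mem/(_ x); rewrite !inE eqxx => /esym/eqP ->.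
- move=> m a alpha beta [|x s] /=; last by rewrite mulr0 addr0.
  by rewrite /pairing mulmxDr -scalemxAr !mxE.
- by exists 1%N => m [|x []].
- move=> c s ac k; case: s => [|i [|j s]] /=;
    try exact: (@Ck_on_cst _ _ _ _ _ (0 : R)).
  apply: (@Ck_on_eq _ _ _ _ _
    (fun x => tcoord c (cinv c x) (X (cinv c x)) 0 i)); first exact: cimg_open.
    by move=> x /cinvP[cx _]; rewrite pairing_coord_covec.
  exact: (Ck_on_mx _ _ (@cimg_open _ _ _ c)).1 (sX c ac k) 0 i.
Qed.

Lemma sym_mul_fun f Q m s : sym_mul (sym_of_fun f) Q m s = f m * Q m s.
Proof.
rewrite /sym_mul (bigD1 [tuple of nseq (size s) false])//= mask_false.
rewrite map_nseq mask_true// big1 ?addr0// => b /eqP bn.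
rewrite homogeneous_fun ?mul0r// size_mask ?size_tuple// => /eqP.
rewrite -leqn0 leqNgt -has_count => /hasPn b0; apply: bn.
apply/val_inj => /=; rewrite -[in RHS](size_tuple b).
by apply/all_pred1P/allP => x /b0; case: x.
Qed.

Lemma is_symfield_mul_fun f Q : smooth_fun f -> is_symfield Q ->
  is_symfield (sym_mul (sym_of_fun f) Q).
Proof.
move=> sf sQ; split.
- by move=> m s s' ss'; rewrite !sym_mul_fun (symf_sym sQ m ss').
- by move=> m a alpha beta s; rewrite !sym_mul_fun symf_linear//; ring.
- have [N QN] := symf_finite sQ.
  by exists N => m s /QN; rewrite sym_mul_fun => ->; rewrite mulr0.
- move=> c s ac k; under eq_fun do rewrite sym_mul_fun.
  by apply: Ck_onM; [exact: cimg_open | exact: sf | exact: symf_smooth].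
Qed.

Lemma sym_mul_vf2 X Y m alpha beta :
  sym_mul (sym_of_vf X) (sym_of_vf Y) m [:: alpha; beta] =
  pairing alpha (X m) * pairing beta (Y m) +
  pairing beta (X m) * pairing alpha (Y m).
Proof.
rewrite (@sym_mul_size _ _ _ _ 2)// !sum_tupleS !sum_tuple0 /=.
by rewrite !mul0r add0r addr0.
Qed.

Lemma homogeneous_mul_vf X Y :
  homogeneous 2 (sym_mul (sym_of_vf X) (sym_of_vf Y)).
Proof. exact: homogeneous_mul (@homogeneous_vf X) (@homogeneous_vf Y). Qed.

Lemma perm2P (T : eqType) (a b : T) s : perm_eq [:: a; b] s ->
  s = [:: a; b] \/ s = [:: b; a].
Proof.
move=> p; have := perm_size p; case: s p => [|x [|y []]]// p _.
have := perm_mem p x; rewrite !inE eqxx/= => /orP[]/eqP xE; subst x.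
  by left; move: p; rewrite perm_cons => /perm_mem/(_ b); rewrite !inE eqxx => /esym/eqP ->.
right; have : perm_eq [:: b; a] [:: b; y].
  by apply: perm_trans p; apply/permPl/(perm_catC [:: _] [:: _]).
by rewrite perm_cons => /perm_mem/(_ a); rewrite !inE eqxx => /esym/eqP ->.
Qed.

Lemma is_symfield_mul_vf X Y : smooth_vf X -> smooth_vf Y ->
  is_symfield (sym_mul (sym_of_vf X) (sym_of_vf Y)).
Proof.
move=> sX sY; have h2 := @homogeneous_mul_vf X Y; split.
- move=> m s s' ss'; have [s2|/eqP s2] := eqVneq (size s) 2%N; last first.
    by rewrite !h2 -?(perm_size ss').
  case: s s2 ss' => [|a [|b []]]// _ /perm2P[] ->//.
  by rewrite !sym_mul_vf2 addrC.
- move=> m a alpha beta s; have [s2|/eqP s2] := eqVneq (size s) 1%N; last first.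
    by rewrite !h2 ?mulr0 ?addr0//= => -[].
  case: s s2 => [|b []]// _; rewrite !sym_mul_vf2 /pairing !mulmxDr -!scalemxAr.
  by rewrite !mxE; ring.
- by exists 2%N => m s s2; apply: h2 => s2'; rewrite s2' ltnn in s2.
- move=> c s ac k; have [s2|/eqP s2] := eqVneq (size s) 2%N; last first.
    under eq_fun do rewrite h2 ?size_map//.
    exact: (@Ck_on_cst _ _ _ _ _ (0 : R)).
  case: s s2 => [|i [|j []]]// _; under eq_fun do rewrite sym_mul_vf2.
  have sXi Z l (sZ : smooth_vf Z) :=
    symf_smooth (is_symfield_vf sZ) [:: l] ac k.
  have oU := @cimg_open _ _ _ c.
  by apply: Ck_onD => //; apply: Ck_onM => //;
     [exact: (sXi X)|exact: (sXi Y)|exact: (sXi X)|exact: (sXi Y)].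
Qed.

Lemma is_symfield_sum I (r : seq I) (F : I -> symfield M) :
  (forall i, is_symfield (F i)) ->
  is_symfield (fun m s => \sum_(i <- r) F i m s).
Proof.
move=> sF; split.
- by move=> m s s' ss'; apply: eq_bigr => i _; exact: symf_sym.
- move=> m a alpha beta s; rewrite mulr_sumr -big_split/=; apply: eq_bigr => i _.
  exact: symf_linear.
- elim: r => [|i r [N FN]]; first by exists 0%N => *; rewrite big_nil.
  have [N' FN'] := symf_finite (sF i); exists (maxn N N') => m s.
  by rewrite gtn_max => /andP[/FN h /FN' h']; rewrite big_cons h h' addr0.
- move=> c s ac k; apply: Ck_on_sum => [|i]; first exact: cimg_open.
  exact: symf_smooth.
Qed.

Section Evaluation.
Variables (m0 : M) (a : 'cV[R]_n).

(* Dividing by r! turns the shuffle product into the ordinary product of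
   polynomials in a. *)
Definition sym_eval r P : R := P m0 (nseq r a) / r`!%:R.

Lemma sym_eval_mul r q P Q : homogeneous r P -> homogeneous q Q ->
  sym_eval (r + q) (sym_mul P Q) = sym_eval r P * sym_eval q Q.
Proof.
move=> hP hQ; rewrite /sym_eval (@sym_mul_size _ _ _ _ (r + q)) ?size_nseq//.
(* On equal covectors all shuffles of the right size give the same term, and every other mask
   vanishes by homogeneity. *)
have term (b : (r + q).-tuple bool) :
    P m0 (mask b (nseq (r + q) a)) *
      Q m0 (mask [seq ~~ x | x <- b] (nseq (r + q) a)) =
    (count id b == r)%:R * (P m0 (nseq r a) * Q m0 (nseq q a)).
  rewrite !mask_nseq ?size_map ?size_tuple//.
  have [br|/eqP br] := eqVneq (count id b) r; last first.
    by rewrite hP ?size_nseq// !mul0r.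
  have -> : count id [seq ~~ x | x <- b] = q.
    by apply/eqP; rewrite -(eqn_add2l r) -{1}br count_negb size_tuple.
  by rewrite br mul1r.
rewrite (eq_bigr _ (fun b _ => term b)).
rewrite -mulr_suml sum_tuple_count.
have : 'C(r + q, r)%:R * (r`!%:R * q`!%:R) = (r + q)`!%:R :> R.
  by rewrite -!natrM -[in RHS](bin_fact (leq_addr q r)) addKn.
move=> <-.
have f0 k : k`!%:R != 0 :> R by rewrite pnatr_eq0 -lt0n fact_gt0.
have b0 : 'C(r + q, r)%:R != 0 :> R by rewrite pnatr_eq0 -lt0n bin_gt0 leq_addr.
by field; rewrite !f0 b0.
Qed.

Lemma sym_eval_fun f : sym_eval 0 (sym_of_fun f) = f m0.
Proof. by rewrite /sym_eval /= divr1. Qed.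

Lemma sym_eval_vf X : sym_eval 1 (sym_of_vf X) = pairing a (X m0).
Proof. by rewrite /sym_eval /= divr1. Qed.

End Evaluation.

End SymmetricAlgebra.

(** * The bracket evaluated on equal covectors *)

Section Bracket.
Variables (R : realType) (n : nat) (M : smooth_manifold R n).
Variables (nabla : (M -> 'rV[R]_n) -> (M -> 'rV[R]_n) -> M -> 'rV[R]_n).
Variables (B : symfield M -> symfield M -> symfield M).
Hypothesis sB : is_schouten nabla B.
Variables (m0 : M) (a : 'cV[R]_n).
Implicit Types (P Q : symfield M) (f g : M -> R) (X Y : M -> 'rV[R]_n).

Local Notation ev := (sym_eval m0 a).

(** The predecessor is truncated only for [p = q = 0], where the bracket vanishes and any degree of
    evaluation gives 0. *)
Definition bracket_eval p q P Q : R := ev (p + q).-1 (B P Q).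

Local Notation br := bracket_eval.

Lemma schouten_degree0 P Q m s : is_symfield P -> is_symfield Q ->
  homogeneous 0 P -> homogeneous 0 Q -> B P Q m s = 0.
Proof. by move=> sP sQ hP hQ; rewrite (schouten_degree sB m sP sQ hP hQ). Qed.

Lemma homogeneous_schouten p q P Q : is_symfield P -> is_symfield Q ->
  homogeneous p P -> homogeneous q Q -> homogeneous (p + q).-1 (B P Q).
Proof.
move=> sP sQ hP hQ m s sz; rewrite (schouten_degree sB m sP sQ hP hQ)//.
by move=> szE; apply: sz; rewrite -szE.
Qed.

Lemma sym_eval0 r P : (forall m s, P m s = 0) -> ev r P = 0.
Proof. by move=> P0; rewrite /sym_eval P0 mul0r. Qed.

Lemma bracket_degree0 P Q : is_symfield P -> is_symfield Q ->
  homogeneous 0 P -> homogeneous 0 Q -> br 0 0 P Q = 0.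
Proof. by move=> *; apply: sym_eval0 => m s; exact: schouten_degree0. Qed.

Lemma bracket_mul p q q' P Q Q' :
  is_symfield P -> is_symfield Q -> is_symfield Q' ->
  homogeneous p P -> homogeneous q Q -> homogeneous q' Q' ->
  br p (q + q') P (sym_mul Q Q') =
  br p q P Q * ev q' Q' + ev q Q * br p q' P Q'.
Proof.
move=> sP sQ sQ' hP hQ hQ'.
have hBQ := homogeneous_schouten sP sQ hP hQ.
have hBQ' := homogeneous_schouten sP sQ' hP hQ'.
rewrite {1}/br.
have -> : ev (p + (q + q')).-1 (B P (sym_mul Q Q')) =
    ev (p + (q + q')).-1 (sym_mul (B P Q) Q') +
    ev (p + (q + q')).-1 (sym_mul Q (B P Q')).
  by rewrite /sym_eval -mulrDl (schouten_derivation sB _ _ sP sQ sQ' hP).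
congr (_ + _).
  (* If [p = q = 0], truncation breaks the additivity of degrees, but both sides contain the bracket
     of two fields of degree 0 and vanish. The second summand is treated in the same way. *)
  have [|pq0] := posnP (p + q).
    move=> /eqP; rewrite addn_eq0 => /andP[/eqP p0 /eqP q0]; subst p q.
    rewrite bracket_degree0// mul0r; apply: sym_eval0 => m s.
    by rewrite /sym_mul big1// => b _; rewrite schouten_degree0// mul0r.
  rewrite (_ : (p + (q + q')).-1 = ((p + q).-1 + q')%N) ?sym_eval_mul//.
  by rewrite addnA -(prednK pq0).
have [|pq0] := posnP (p + q').
  move=> /eqP; rewrite addn_eq0 => /andP[/eqP p0 /eqP q0]; subst p q'.
  rewrite bracket_degree0// mulr0; apply: sym_eval0 => m s.
  by rewrite /sym_mul big1// => b _; rewrite schouten_degree0// mulr0.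
rewrite (_ : (p + (q + q')).-1 = (q + (p + q').-1)%N) ?sym_eval_mul//.
by rewrite addnCA -(prednK pq0) addnS.
Qed.

Lemma bracketC p q P Q : is_symfield P -> is_symfield Q ->
  br p q P Q = br q p Q P.
Proof. by move=> sP sQ; rewrite /br addnC /sym_eval (schouten_comm sB). Qed.

Lemma schouten0 P m s : is_symfield P -> B (fun _ _ => 0) P m s = 0.
Proof.
move=> sP.
have s0 : is_symfield (fun (_ : M) (_ : seq 'cV[R]_n) => 0 : R).
  split=> //; first by move=> *; rewrite mulr0 addr0.
    by exists 0%N.
  by move=> *; move=> k; exact: (@Ck_on_cst _ _ _ _ _ (0 : R)).
have := schouten_linear sB (-1) m s s0 s0 sP.
by rewrite mulr0 addr0 mulN1r addNr.
Qed.

Lemma bracket_sum p q I (r : seq I) (F : I -> symfield M) P :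
  (forall i, is_symfield (F i)) -> is_symfield P ->
  br p q P (fun m s => \sum_(i <- r) F i m s) = \sum_(i <- r) br p q P (F i).
Proof.
move=> sF sP; rewrite /br /sym_eval -mulr_suml; congr (_ / _).
elim: r => [|i r IH].
  rewrite big_nil -[RHS](schouten0 m0 (nseq (p + q).-1 a) sP) (schouten_comm sB)//.
    by congr (B _ _ _ _); apply/funext => m; apply/funext => s; rewrite big_nil.
  exact: is_symfield_sum.
have sr : is_symfield (fun m s => \sum_(i <- r) F i m s) by exact: is_symfield_sum.
rewrite big_cons -IH (schouten_comm sB)//; last exact: is_symfield_sum.
have := schouten_linear sB 1 m0 (nseq (p + q).-1 a) (sF i) sr sP.
rewrite mul1r (schouten_comm sB _ _ sP (sF i)) (schouten_comm sB _ _ sP sr) => <-.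
congr (B _ _ _ _); apply/funext => m; apply/funext => s.
by rewrite big_cons mul1r.
Qed.

Lemma bracket_fun_vf f X : smooth_fun f -> smooth_vf X ->
  br 0 1 (sym_of_fun f) (sym_of_vf X) = vf_act X f m0.
Proof.
move=> sf sX; rewrite bracketC; [|exact: is_symfield_fun|exact: is_symfield_vf].
by rewrite /br /sym_eval (schouten_vf_fun sB)//= divr1.
Qed.

Lemma bracket_vf_vf X Y : smooth_vf X -> smooth_vf Y ->
  br 1 1 (sym_of_vf X) (sym_of_vf Y) =
  pairing a (nabla X Y m0) + pairing a (nabla Y X m0).
Proof.
move=> sX sY; rewrite /br /sym_eval (schouten_vf_vf sB)//= divr1.
by rewrite /pairing mulmxDl mxE.
Qed.

Section Quadratic.
Variables (E : 'I_n -> M -> 'rV[R]_n) (f : 'I_n -> 'I_n -> M -> R).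
Hypotheses (sE : forall i, smooth_vf (E i)).
Hypotheses (sf : forall i j, smooth_fun (f i j)).
Hypothesis fC : forall i j, f i j = f j i.

Local Notation SE i := (sym_of_vf (E i)).
Local Notation e i := (pairing a (E i m0)).
(** Half the gradient of the quadratic form of the [f k l] in the variables [e]; in the application,
    rho^2 times the components of vt(a). *)
Let w k := \sum_l f k l m0 * e l.
Let s i k := pairing a (nabla (E i) (E k) m0) + pairing a (nabla (E k) (E i) m0).

Definition quadratic : symfield M := fun m l => \sum_(ij : 'I_n * 'I_n)
  sym_mul (sym_of_fun (f ij.1 ij.2)) (sym_mul (SE ij.1) (SE ij.2)) m l.

Let sF i j : is_symfield (sym_of_fun (f i j)) := is_symfield_fun (sf i j).
Let sV i : is_symfield (SE i) := is_symfield_vf (sE i).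

Lemma is_symfield_quadratic : is_symfield quadratic.
Proof.
apply: is_symfield_sum => -[i j] /=; apply: is_symfield_mul_fun => //.
exact: is_symfield_mul_vf.
Qed.

Lemma homogeneous_quadratic : homogeneous 2 quadratic.
Proof.
move=> m l l2; rewrite /quadratic big1// => -[i j] _ /=.
by rewrite sym_mul_fun homogeneous_mul_vf// mulr0.
Qed.

(** The Leibniz rule differentiates the coefficient and the two fields of each product. The two
    field terms coincide after exchanging indices, by the symmetry [fC], whence the factor 2. *)
Lemma bracket_quadratic q Q : is_symfield Q -> homogeneous q Q ->
  br q 2 Q quadratic = \sum_i \sum_j br q 0 Q (sym_of_fun (f i j)) * (e i * e j)
    + 2 * \sum_i w i * br q 1 Q (SE i).
Proof.
move=> sQ hQ; rewrite bracket_sum//; last first.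
  move=> [i j] /=; apply: is_symfield_mul_fun => //; exact: is_symfield_mul_vf.
have term i j : br q 2 Q (sym_mul (sym_of_fun (f i j)) (sym_mul (SE i) (SE j))) =
    br q 0 Q (sym_of_fun (f i j)) * (e i * e j) +
    (f i j m0 * e j * br q 1 Q (SE i) + f i j m0 * e i * br q 1 Q (SE j)).
  have hV k := @homogeneous_vf _ _ _ (E k).
  rewrite -[in LHS](add0n 2%N) bracket_mul//; first last.
  - exact: homogeneous_mul_vf.
  - exact: homogeneous_fun.
  - exact: is_symfield_mul_vf.
  rewrite -[in X in _ + X](addn1 1%N) bracket_mul// -[ev 2 _]/(ev (1 + 1) _).
  by rewrite sym_eval_mul// sym_eval_fun !sym_eval_vf; ring.
under eq_bigr do rewrite term.
rewrite -(pair_big xpredT xpredT (fun i j =>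
   br q 0 Q (sym_of_fun (f i j)) * (e i * e j) +
    (f i j m0 * e j * br q 1 Q (SE i) + f i j m0 * e i * br q 1 Q (SE j))))/=.
under eq_bigr do rewrite big_split/= big_split/=.
rewrite big_split/= big_split/=; congr (_ + _).
rewrite [X in _ + X]exchange_big/= -big_split mulr_sumr/=; apply: eq_bigr => i _.
rewrite /w mulr_suml mulr_sumr -big_split/=; apply: eq_bigr => j _.
by rewrite (fC j i); ring.
Qed.

Lemma bracket_quadratic_fun g : smooth_fun g ->
  br 0 2 (sym_of_fun g) quadratic = 2 * \sum_k w k * vf_act (E k) g m0.
Proof.
move=> sg; have sg' := is_symfield_fun sg; have hg := @homogeneous_fun _ _ _ g.
rewrite bracket_quadratic// big1 ?add0r => [|i _].
  by under eq_bigr do rewrite bracket_fun_vf//.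
rewrite big1// => j _; rewrite bracket_degree0 ?mul0r//; exact: homogeneous_fun.
Qed.

Lemma bracket_quadratic_vf i :
  br 1 2 (SE i) quadratic =
  \sum_k \sum_l vf_act (E i) (f k l) m0 * (e k * e l) + 2 * \sum_k w k * s i k.
Proof.
have hV k := @homogeneous_vf _ _ _ (E k).
rewrite bracket_quadratic//; congr (_ + 2 * _).
  apply: eq_bigr => k _; apply: eq_bigr => l _.
  by rewrite bracketC// bracket_fun_vf.
by apply: eq_bigr => k _; rewrite bracket_vf_vf.
Qed.

(** [bracket_quadratic] is applied in the second argument and then, by commutativity, in the first.
    Derivatives of the coefficients arise from both arguments with factor 2 each; brackets of two
    fields [E] arise once, with factor 2 * 2. *)
Lemma bracket_quadratic2 :
  br 2 2 quadratic quadratic =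
  4 * (\sum_k w k * \sum_i \sum_j vf_act (E k) (f i j) m0 * (e i * e j)
       + \sum_i \sum_k w i * w k * s i k).
Proof.
have [sQ hQ] := (is_symfield_quadratic, homogeneous_quadratic).
rewrite bracket_quadratic//.
have -> : \sum_i w i * br 2 1 quadratic (SE i) =
    \sum_k w k * \sum_i \sum_j vf_act (E k) (f i j) m0 * (e i * e j)
    + 2 * \sum_i \sum_k w i * w k * s i k.
  rewrite mulr_sumr -big_split/=; apply: eq_bigr => i _.
  rewrite bracketC// bracket_quadratic_vf mulrDr mulrCA; congr (_ + _ * _).
  by rewrite mulr_sumr; apply: eq_bigr => k _; rewrite mulrA.
have -> : \sum_i \sum_j br 2 0 quadratic (sym_of_fun (f i j)) * (e i * e j) =
    2 * \sum_k w k * \sum_i \sum_j vf_act (E k) (f i j) m0 * (e i * e j).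
  under eq_bigr => i _ do under eq_bigr => j _ do
    rewrite bracketC// bracket_quadratic_fun// -mulrA mulr_suml.
  under eq_bigr do rewrite -mulr_sumr exchange_big/=.
  rewrite -mulr_sumr exchange_big/=; congr (_ * _); apply: eq_bigr => k _.
  rewrite mulr_sumr; apply: eq_bigr => i _.
  by rewrite mulr_sumr; apply: eq_bigr => j _; rewrite -mulrA.
by ring.
Qed.

(* Locality is replaced by algebra: with {P, Q} := br P Q, one has
   {chi, quadratic} = 0 because d chi vanishes at m0, hence {chi, vt} = 0, and
   expanding {chi vt, chi vt} by the Leibniz rule leaves chi^2 {vt, vt} = 0. *)
Lemma quadratic_poisson vt chi : is_symfield vt -> homogeneous 2 vt ->
  (forall m l, B vt vt m l = 0) -> smooth_fun chi -> chi m0 != 0 ->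
  (forall k, vf_act (E k) chi m0 = 0) ->
  quadratic = sym_mul (sym_of_fun chi) vt ->
  \sum_k w k * (\sum_i \sum_j vf_act (E k) (f i j) m0 * (e i * e j))
    + \sum_i \sum_k w i * w k * s i k = 0.
Proof.
move=> svt hvt Bvt schi chi0 dchi QE.
have [sQ hQ] := (is_symfield_quadratic, homogeneous_quadratic).
have [sx hx] := (is_symfield_fun schi, @homogeneous_fun _ _ _ chi).
have xQ : br 0 2 (sym_of_fun chi) quadratic = 0.
  by rewrite bracket_quadratic_fun// big1 ?mulr0// => k _; rewrite dchi mulr0.
have xvt : br 0 2 (sym_of_fun chi) vt = 0.
  move: xQ; rewrite QE -{1}(add0n 2%N) bracket_mul// bracket_degree0// mul0r add0r.
  by rewrite sym_eval_fun => /eqP; rewrite mulf_eq0 (negbTE chi0) => /eqP.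
have vtQ : br 2 2 vt quadratic = 0.
  rewrite QE -[X in br 2 X](add0n 2%N) bracket_mul// bracketC// xvt mul0r add0r.
  by rewrite [br 2 2 vt vt]sym_eval0 ?mulr0.
have : br 2 2 quadratic quadratic = 0.
  rewrite {2}QE -[X in br 2 X](add0n 2%N) bracket_mul// bracketC// xQ mul0r add0r.
  by rewrite bracketC// vtQ mulr0.
by rewrite bracket_quadratic2 => /eqP; rewrite mulf_eq0 pnatr_eq0/= => /eqP.
Qed.

End Quadratic.

End Bracket.

(** * Fields on the manifold and along curves *)

Section Frame.
Variables (R : realType) (n : nat) (M : smooth_manifold R n).
Variables (c : chart R n M) (m0 : M) (K : set M) (rho : M -> R).
Hypotheses (ac : atlas M c) (rhoP : is_bump c m0 K rho).

Lemma bump_off m : ~ cdom c m -> rho m = 0.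
Proof. by move=> cm; apply: (bump_supp rhoP) => /(bump_dom rhoP). Qed.

Lemma smooth_bump_mul (F : M -> R) : smooth_on (cimg c) (F \o cinv c) ->
  smooth_fun (fun m => rho m * F m).
Proof.
move=> sF c' ac' k.
apply: (Ck_on_supp ac ac' (bump_closed rhoP) (bump_dom rhoP)).
  by move=> m /(bump_supp rhoP) ->; rewrite mul0r.
apply: (@Ck_on_sub _ _ _ _ _ (cimg c)); first by move=> _ [m [cm _] <-]; exists m.
by apply: Ck_onM; [exact: cimg_open | exact: (bump_smooth rhoP) | exact: sF].
Qed.

Definition frame (i : 'I_n) (m : M) : 'rV[R]_n := rho m *: coord_vec c m i.

Lemma smooth_frame i : smooth_vf (frame i).
Proof.
move=> c' ac' k.
apply/Ck_on_mx; first exact: cimg_open.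
move=> a j; rewrite ord1 => {a}.
apply: (@Ck_on_supp _ _ _ c c' K (fun m => tcoord c' m (frame i m) 0 j)) => //.
- exact: bump_closed rhoP.
- exact: bump_dom rhoP.
- by move=> m /(bump_supp rhoP) rho0; rewrite /frame rho0 scale0r tcoord0 mxE.
have oU := @open_overlap _ _ _ c c'.
have sT := atlas_smooth ac ac' k.+1.
apply: (@Ck_on_eq _ _ _ _ _ (fun x => (rho \o cinv c) x *
    ('D_(delta_mx 0 i) (cmap c' \o cinv c) x) 0 j)) => //.
  move=> _ [m [cm c'm] <-] /=; rewrite cmapK// /frame tcoordZ// mxE.
  congr (_ * _); rewrite tcoordE coord_vecE jac_comp//.
  - exact: chart_at_atlas.
  - exact: chart_at_dom.
apply: Ck_onM => //.
  apply: Ck_on_sub (bump_smooth rhoP k).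
  by move=> _ [m [cm _] <-]; exists m.
exact: (Ck_on_mx _ _ oU).1 (sT.2 _).2 0 j.
Qed.

End Frame.

(** * Linear combinations of vector fields under a connection *)

Section VectorFields.
Variables (R : realType) (n : nat) (M : smooth_manifold R n).
Implicit Types (X Y : M -> 'rV[R]_n).

Lemma smooth_fun_cst (r : R) : smooth_fun (fun _ : M => r).
Proof. by move=> c ac k; exact: (@Ck_on_cst _ _ _ _ _ r). Qed.

Lemma smooth_vf_lin (r : R) X Y : smooth_vf X -> smooth_vf Y ->
  smooth_vf (fun p => r *: X p + Y p).
Proof.
move=> sX sY c ac k; have oU := @cimg_open _ _ _ c.
apply/Ck_on_mx => // i j; rewrite ord1.
apply: (@Ck_on_eq _ _ _ _ _ (fun x => r * tcoord c (cinv c x) (X (cinv c x)) 0 j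
    + tcoord c (cinv c x) (Y (cinv c x)) 0 j)) => //.
  by move=> x /cinvP[cx _]; rewrite tcoord_linear// !mxE.
apply: Ck_onD => //; last exact: (Ck_on_mx _ _ oU).1 (sY c ac k) 0 j.
apply: Ck_onM => //; first exact: Ck_on_cst.
exact: (Ck_on_mx _ _ oU).1 (sX c ac k) 0 j.
Qed.

Lemma smooth_vf0 : smooth_vf (fun _ : M => 0 : 'rV[R]_n).
Proof.
move=> c ac k; apply: (@Ck_on_eq _ _ _ _ _ (cst 0)); first exact: cimg_open.
  by move=> x _; rewrite tcoord0.
exact: Ck_on_cst.
Qed.

Lemma smooth_vf_sum I (r : seq I) (a : I -> R) (X : I -> M -> 'rV[R]_n) :
  (forall i, smooth_vf (X i)) -> smooth_vf (fun p => \sum_(i <- r) a i *: X i p).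
Proof.
move=> sX; elim: r => [|i r IH].
  rewrite (_ : (fun p => _) = (fun _ => 0)); first exact: smooth_vf0.
  by apply/funext => p; rewrite big_nil.
rewrite (_ : (fun p => _) =
    (fun p => a i *: X i p + \sum_(j <- r) a j *: X j p)).
  exact: smooth_vf_lin.
by apply/funext => p; rewrite big_cons.
Qed.

Variable nabla : (M -> 'rV[R]_n) -> (M -> 'rV[R]_n) -> M -> 'rV[R]_n.
Hypothesis cn : is_connection nabla.

Lemma conn_lin (r : R) X X' Y m : smooth_vf X -> smooth_vf X' -> smooth_vf Y ->
  nabla (fun p => r *: X p + X' p) Y m = r *: nabla X Y m + nabla X' Y m.
Proof.
move=> sX sX' sY; have s0 := smooth_vf0.
have srX : smooth_vf (fun p => r *: X p).
  have := smooth_vf_lin r sX s0.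
  by congr smooth_vf; apply/funext => p; rewrite addr0.
rewrite (conn_addl cn m srX sX' sY); congr (_ + _).
exact: (conn_scalel cn (f := fun _ => r)) (smooth_fun_cst r) sX sY.
Qed.

Lemma conn0 Y m : smooth_vf Y -> nabla (fun _ => 0) Y m = 0.
Proof.
move=> sY; have := conn_lin (-1) m smooth_vf0 smooth_vf0 sY.
by rewrite scaler0 addr0 scaleN1r addNr.
Qed.

Lemma conn_sum I (r : seq I) (a : I -> R) (X : I -> M -> 'rV[R]_n) Y m :
  (forall i, smooth_vf (X i)) -> smooth_vf Y ->
  nabla (fun p => \sum_(i <- r) a i *: X i p) Y m =
  \sum_(i <- r) a i *: nabla (X i) Y m.
Proof.
move=> sX sY; elim: r => [|i r IH].
  rewrite big_nil -[RHS](conn0 m sY); congr (nabla _ Y m).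
  by apply/funext => p; rewrite big_nil.
rewrite big_cons -IH -conn_lin//; last exact: smooth_vf_sum.
by congr (nabla _ Y m); apply/funext => p; rewrite big_cons.
Qed.

End VectorFields.

(** * Covariant derivative of sums along a curve *)

Section FieldsAlongCurves.
Variables (R : realType) (n : nat) (M : smooth_manifold R n).
Variables (I : set R) (gamma : R -> M).
Hypotheses (oI : open I) (sgamma : smooth_curve I gamma).
Implicit Types (c : chart R n M) (V W : R -> 'rV[R]_n).

Lemma Ck_on_curve c (F : M -> R) k : atlas M c ->
  Ck_on k (cimg c) (F \o cinv c) ->
  Ck_on k (I `&` gamma @^-1` cdom c) (F \o gamma).
Proof.
move=> ac UF; have oU := open_curve_dom oI sgamma (c := c).
apply: (@Ck_on_eq _ _ _ _ _ ((F \o cinv c) \o (cmap c \o gamma))) => //.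
  by move=> t [It ct] /=; rewrite cmapK.
apply: Ck_on_comp oU (@cimg_open _ _ _ c) _ _ UF; last exact: sgamma.2.
by move=> t [It ct]; exact: cimg_cmap.
Qed.

Lemma smooth_vf_curve (X : M -> 'rV[R]_n) : smooth_vf X ->
  smooth_vf_along I gamma (X \o gamma).
Proof.
move=> sX c ac k; have oU := open_curve_dom oI sgamma (c := c).
apply/Ck_on_mx => // i j; rewrite ord1.
apply: (Ck_on_curve (F := fun m => tcoord c m (X m) 0 j)) => //.
exact: (Ck_on_mx _ _ (@cimg_open _ _ _ c)).1 (sX c ac k) 0 j.
Qed.

Lemma smooth_along_lin (h : R -> R) V W : smooth_on I h ->
  smooth_vf_along I gamma V -> smooth_vf_along I gamma W ->
  smooth_vf_along I gamma (fun s => h s *: V s + W s).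
Proof.
move=> sh sV sW c ac k; have oU := open_curve_dom oI sgamma (c := c).
apply/Ck_on_mx => // i j; rewrite ord1.
apply: (@Ck_on_eq _ _ _ _ _ (fun t => h t * tcoord c (gamma t) (V t) 0 j
    + tcoord c (gamma t) (W t) 0 j)) => //.
  by move=> t [It ct]; rewrite tcoord_linear// !mxE.
apply: Ck_onD => //; last exact: (Ck_on_mx _ _ oU).1 (sW c ac k) 0 j.
apply: Ck_onM => //; last exact: (Ck_on_mx _ _ oU).1 (sV c ac k) 0 j.
by apply: Ck_on_sub (sh k) => t [].
Qed.

Lemma smooth_along0 : smooth_vf_along I gamma (fun _ => 0).
Proof.
move=> c ac k; have oU := open_curve_dom oI sgamma (c := c).
apply: (@Ck_on_eq _ _ _ _ _ (cst 0)) => //; last exact: Ck_on_cst.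
by move=> t _; rewrite tcoord0.
Qed.

Lemma smooth_along_scale (h : R -> R) V : smooth_on I h ->
  smooth_vf_along I gamma V -> smooth_vf_along I gamma (fun s => h s *: V s).
Proof.
move=> sh sV; have := smooth_along_lin sh sV smooth_along0.
by congr smooth_vf_along; apply/funext => s; rewrite addr0.
Qed.

Lemma smooth_along_sum J (r : seq J) (h : J -> R -> R) (V : J -> R -> 'rV[R]_n) :
  (forall j, smooth_on I (h j)) -> (forall j, smooth_vf_along I gamma (V j)) ->
  smooth_vf_along I gamma (fun s => \sum_(j <- r) h j s *: V j s).
Proof.
move=> sh sV; elim: r => [|i r IH].
  rewrite (_ : (fun p => _) = (fun _ => 0)); first exact: smooth_along0.
  by apply/funext => p; rewrite big_nil.
rewrite (_ : (fun p => _) =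
    (fun p => h i p *: V i p + \sum_(j <- r) h j p *: V j p)).
  exact: smooth_along_lin.
by apply/funext => p; rewrite big_cons.
Qed.

Variable nabla : (M -> 'rV[R]_n) -> (M -> 'rV[R]_n) -> M -> 'rV[R]_n.
Variable D : (R -> 'rV[R]_n) -> R -> 'rV[R]_n.
Hypothesis cD : is_cov_along nabla I gamma D.

Lemma cov0 t : I t -> D (fun _ => 0) t = 0.
Proof.
move=> It.
have s0 : smooth_on I (fun _ : R => 0 : R) by move=> k; exact: (@Ck_on_cst _ _ _ _ _ (0 : R)).
have := cov_leibniz cD s0 smooth_along0 It.
by rewrite scaler0 derive1E derive_cst !scale0r addr0.
Qed.

Lemma cov_sum J (r : seq J) (h : J -> R -> R) (V : J -> R -> 'rV[R]_n) t :
  (forall j, smooth_on I (h j)) -> (forall j, smooth_vf_along I gamma (V j)) ->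
  I t ->
  D (fun s => \sum_(j <- r) h j s *: V j s) t =
  \sum_(j <- r) ('D_1 (h j) t *: V j t + h j t *: D (V j) t).
Proof.
move=> sh sV It; elim: r => [|i r IH].
  rewrite big_nil -[RHS](cov0 It); congr (D _ t).
  by apply/funext => p; rewrite big_nil.
rewrite big_cons -IH -derive1E -(cov_leibniz cD (sh i) (sV i) It).
rewrite -(cov_add cD _ _ It).
- by congr (D _ t); apply/funext => p; rewrite big_cons.
- exact: smooth_along_scale.
- exact: smooth_along_sum.
Qed.

End FieldsAlongCurves.

(** * The geodesic equation in a chart *)

Section GeodesicEquation.
Variables (R : realType) (n : nat) (M : smooth_manifold R n).
Variables (I : set R) (gamma : R -> M).
Hypotheses (oI : open I) (sgamma : smooth_curve I gamma).
Variables (c : chart R n M) (t0 : R) (K : set M) (rho : M -> R).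
Hypotheses (ac : atlas M c) (It0 : I t0) (ct0 : cdom c (gamma t0)).
Hypothesis rhoP : is_bump c (gamma t0) K rho.

Local Notation m0 := (gamma t0).
Local Notation E := (frame c rho).
Local Notation vel i := (fun t => tcoord c (gamma t) (velocity gamma t) 0 i).

(** [cov_leibniz] takes coefficients smooth on all of [I], whereas the chart components of the
    velocity are smooth only while the curve stays in the chart. A factor rho removes the
    obstruction. *)
Lemma smooth_bump_curve (G : R -> R) :
  smooth_on (I `&` gamma @^-1` cdom c) G ->
  smooth_on I (fun t => rho (gamma t) * G t).
Proof.
move=> sG k; apply: Ck_on_pointwise => t It.
have [ct|nct] := pselect (cdom c (gamma t)).
  have oU := open_curve_dom oI sgamma (c := c).
  apply: (@Ck_on_sub _ _ _ _ _ (I `&` gamma @^-1` cdom c)); first by move=> _ ->.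
  apply: (Ck_onM (f := rho \o gamma)) => //.
  exact: (Ck_on_curve oI sgamma ac (bump_smooth rhoP k)).
apply: (@Ck_on_near _ _ _ _ _ (cst 0)); last exact: Ck_on_cst.
move=> _ ->.
have : \forall s \near t, (~` K) (gamma s).
  apply: (sgamma.1 t It); apply: open_nbhs_nbhs; split.
    by rewrite openC; exact: bump_closed rhoP.
  by move=> /(bump_dom rhoP).
by apply: filterS => s /(bump_supp rhoP) /= ->; rewrite mul0r.
Qed.

Lemma derivable_on (f : R -> R) (U : set R) t : smooth_on U f -> U t ->
  derivable f t 1.
Proof. by move=> sf; apply: Ck_on_derivable (sf 1%N). Qed.

Lemma is_derive_bump_curve : is_derive t0 (1 : R) (rho \o gamma) 0.
Proof.
have ci := cimg_cmap ct0.
have dcg := curve_derivable sgamma ac It0 ct0.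
have := C1_is_derive_comp (@cimg_open _ _ _ c) (bump_smooth rhoP 1%N) ci dcg.
rewrite big1 => [|i _]; last by rewrite /= (bump_flat rhoP) mulr0.
apply: near_eq_is_derive.
have : nbhs t0 (I `&` gamma @^-1` cdom c).
  exact: open_nbhs_nbhs (conj (open_curve_dom oI sgamma (c := c)) (conj It0 ct0)).
by apply: filterS => t [_ ct] /=; rewrite cmapK.
Qed.

(* Compares the two expansions of D (rho^2 gamma') given by the Leibniz rule and
   by rho^2 gamma' = sum_i (rho v^i) E_i. *)
Lemma geodesic_equation nabla D : is_connection nabla ->
  is_cov_along nabla I gamma D -> D (velocity gamma) t0 = 0 ->
  rho m0 ^+ 2 *: (\sum_i 'D_1 (vel i) t0 *: coord_vec c m0 i) +
  \sum_i \sum_j (vel i t0 * vel j t0) *: nabla (E j) (E i) m0 = 0.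
Proof.
move=> cn cD Dv.
have sE i := smooth_frame ac rhoP i.
have sv i : smooth_on (I `&` gamma @^-1` cdom c) (vel i).
  by move=> k; exact: smooth_velocity_coord.
(* One factor rho makes the component of the velocity smooth on [I], the other belongs to the field
   E_i. *)
pose h t := rho (gamma t) * rho (gamma t).
have sh : smooth_on I h.
  apply: smooth_bump_curve => k.
  exact: (Ck_on_curve oI sgamma ac (bump_smooth rhoP k)).
pose hi i t := rho (gamma t) * vel i t.
have shi i : smooth_on I (hi i) by apply: smooth_bump_curve.
have drho := is_derive_bump_curve.
have dh : 'D_1 h t0 = 0.
  have [_] := is_deriveM drho drho.
  by rewrite scaler0 addr0.
have dhi i : 'D_1 (hi i) t0 = rho m0 * 'D_1 (vel i) t0.
  have dvi : derivable (vel i) t0 1 by apply: derivable_on (sv i) _; split.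
  have [_] := is_deriveM drho (derivableP dvi).
  by rewrite scaler0 addr0.
have Dh : D (fun t => h t *: velocity gamma t) t0 = 0.
  rewrite (cov_leibniz cD sh (smooth_velocity oI sgamma) It0) Dv scaler0.
  by rewrite derive1E dh scale0r addr0.
have hE : (fun t => h t *: velocity gamma t) =
    (fun t => \sum_i hi i t *: (E i \o gamma) t).
  apply/funext => t; have [ct|/(bump_off rhoP) r0] := pselect (cdom c (gamma t)).
    rewrite {1}[velocity gamma t](tcoordK ac ct) scaler_sumr.
    by apply: eq_bigr => i _; rewrite /frame !scalerA /h /hi; congr (_ *: _); ring.
  by rewrite /h r0 mul0r scale0r big1// => i _; rewrite /hi r0 mul0r scale0r.
move: Dh; rewrite hE (cov_sum oI sgamma cD _ shi) => // [Dh|i]; last first.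
  exact: smooth_vf_curve.
(* A global field with the prescribed value at one instant is all that [cov_extend] asks for; its
   constant coefficients are normalized by the value of rho at [m0]. *)
pose X p := \sum_j (vel j t0 / rho m0) *: E j p.
have sX : smooth_vf X by exact: smooth_vf_sum.
have Xv : X m0 = velocity gamma t0.
  rewrite [RHS](tcoordK ac ct0); apply: eq_bigr => i _.
  by rewrite /frame scalerA divfK ?(bump_neq0 rhoP).
rewrite -[RHS]Dh big_split/=; congr (_ + _).
  rewrite scaler_sumr; apply: eq_bigr => i _.
  by rewrite dhi /frame !scalerA; congr (_ *: _); ring.
apply: eq_bigr => i _; rewrite (cov_extend cD sX (sE i) It0 Xv) conn_sum//.
rewrite scaler_sumr; apply: eq_bigr => j _; rewrite scalerA /hi.
by congr (_ *: _); field; exact: bump_neq0 rhoP.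
Qed.

End GeodesicEquation.

(** * The equation [vt, vt]_s = 0 in a chart *)

Section PoissonEquation.
Variables (R : realType) (n : nat) (M : smooth_manifold R n).
Variables (vt : symfield M) (m0 : M) (K : set M) (rho : M -> R).
(** In this chart the coordinate vectors at [m0] are the standard basis, and [vf_act] at [m0] is a
    directional derivative in the same coordinates. *)
Let c := chart_at m0.
Let ac : atlas M c := chart_at_atlas m0.
Let cm0 : cdom c m0 := chart_at_dom m0.
Hypotheses (bvt : is_sym_bivector vt) (rhoP : is_bump c m0 K rho).
Variable nabla : (M -> 'rV[R]_n) -> (M -> 'rV[R]_n) -> M -> 'rV[R]_n.
Variable a : 'cV[R]_n.

Local Notation E := (frame c rho).
Local Notation ai i := (pairing a (coord_vec c m0 i)).

Definition bivector_coord (c : chart R n M) i j (m : M) : R :=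
  vt m [:: coord_covec c m i; coord_covec c m j].

Lemma bivector_coordC c' i j : bivector_coord c' i j = bivector_coord c' j i.
Proof. by apply/funext => m; apply: symf2C; exact: bvt.1. Qed.

Lemma smooth_bivector_coord c' i j : atlas M c' -> smooth_on (cimg c') (bivector_coord c' i j \o cinv c').
Proof. by move=> ac'; exact: (symf_smooth bvt.1 [:: i; j] ac'). Qed.

Lemma covec_sum c' m alpha : atlas M c' -> cdom c' m ->
  alpha = \sum_i pairing alpha (coord_vec c' m i) *: coord_covec c' m i.
Proof.
move=> ac' cm; apply/matrixP => k j; rewrite ord1 {j}.
have pd (beta : 'cV[R]_n) : beta k 0 = pairing beta (delta_mx 0 k).
  rewrite /pairing mxE (bigD1 k)//= big1 ?addr0 => [|l lk]; rewrite !mxE ?eqxx ?mul1r//=.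
  by rewrite (negbTE lk) mul0r.
rewrite summxE [LHS]pd (pairing_tcoord _ _ ac' cm); apply: eq_bigr => i _.
by rewrite mxE pd pairing_coord_covec.
Qed.

Lemma bivector_coordE c' m alpha beta : atlas M c' -> cdom c' m ->
  vt m [:: alpha; beta] = \sum_i \sum_j bivector_coord c' i j m *
    (pairing alpha (coord_vec c' m i) * pairing beta (coord_vec c' m j)).
Proof.
move=> ac' cm; have svt := bvt.1.
rewrite {1}(covec_sum alpha ac' cm) symf_suml//; apply: eq_bigr => i _.
rewrite symf2C// {1}(covec_sum beta ac' cm) symf_suml// mulr_sumr.
by apply: eq_bigr => j _; rewrite symf2C// /bivector_coord; ring.
Qed.

(** The instance of [quadratic_poisson] for the fields E_i, divided by rho^4. The remaining rho^2 is
    the one in [geodesic_equation], so the two equations can be combined. *)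
Lemma poisson_equation B : is_schouten nabla B ->
  (forall m s, B vt vt m s = 0) ->
  rho m0 ^+ 2 * (\sum_k tcoord c m0 (sharp vt m0 a) 0 k *
    \sum_i \sum_j 'D_(delta_mx 0 k) (bivector_coord c i j \o cinv c) (cmap c m0) * (ai i * ai j))
  + \sum_i \sum_k tcoord c m0 (sharp vt m0 a) 0 i * tcoord c m0 (sharp vt m0 a) 0 k *
    (pairing a (nabla (E i) (E k) m0) + pairing a (nabla (E k) (E i) m0)) = 0.
Proof.
move=> sB Bvt; have svt := bvt.1.
have sE i := smooth_frame ac rhoP i.
pose f i j m := rho m * bivector_coord c i j m.
have sf i j : smooth_fun (f i j) by apply: (smooth_bump_mul ac rhoP); exact: smooth_bivector_coord.
have fC i j : f i j = f j i by rewrite /f bivector_coordC.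
(* One rho comes from the coefficient, one from each of the two fields, and the 2 from the
   normalization of the symmetric product. The first rho is kept apart to match [smooth_bump_mul]
   and [act]. *)
pose chi m := rho m * (2 * rho m ^+ 2).
have oc := @cimg_open _ _ _ c.
have schi : smooth_fun chi.
  apply: (smooth_bump_mul ac rhoP) => k; apply: Ck_onM => //; first exact: Ck_on_cst.
  by apply: Ck_onX => //; exact: bump_smooth rhoP k.
have r0 := bump_neq0 rhoP.
have chi0 : chi m0 != 0 by rewrite /chi !mulf_neq0 ?expf_neq0 ?pnatr_eq0.
have ci := cimg_cmap cm0.
have drho (v : 'rV[R]_n) : is_derive (cmap c m0) v (rho \o cinv c) 0.
  split; last exact: (bump_flat rhoP).
  exact: Ck_on_derivable (bump_smooth rhoP 1%N) ci.
have cvE k : coord_vec c m0 k = delta_mx 0 k by rewrite coord_vecE jac_id.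
(* As the differential of rho vanishes at [m0], rho passes through the derivative as a constant; the
   second power comes from E_k. *)
have act k F : smooth_on (cimg c) (F \o cinv c) ->
    vf_act (E k) (fun m => rho m * F m) m0 =
    rho m0 ^+ 2 * 'D_(delta_mx 0 k) (F \o cinv c) (cmap c m0).
  move=> sF; rewrite /vf_act /frame -/c cvE.
  have dF : derivable (F \o cinv c) (cmap c m0) (delta_mx 0 k).
    exact: Ck_on_derivable (sF 1%N) ci.
  have dM := is_deriveM (drho (delta_mx 0 k)) (derivableP dF).
  have [_] := is_derive_dirZ (rho m0) (@ex_derive _ _ _ _ _ _ _ dM).
  rewrite (@derive_val _ _ _ _ _ _ _ dM) /= cmapK// scaler0 addr0.
  by rewrite expr2 -mulrA.
have dchi k : vf_act (E k) chi m0 = 0.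
  rewrite act; last first.
    move=> p; apply: Ck_onM => //; first exact: Ck_on_cst.
    by apply: Ck_onX => //; exact: bump_smooth rhoP p.
  have [_] := is_deriveM (is_derive_cst (2 : R) (cmap c m0) (delta_mx 0 k))
    (is_deriveM (drho (delta_mx 0 k)) (drho (delta_mx 0 k))).
  rewrite !(scaler0, addr0) => d0; rewrite -[RHS](mulr0 (rho m0 ^+ 2)).
  by congr (_ * _); exact: d0.
have pE alpha i m : pairing alpha (E i m) = rho m * pairing alpha (coord_vec c m i).
  by rewrite /pairing /frame -scalemxAl mxE.
have QE : quadratic E f = sym_mul (sym_of_fun chi) vt.
  apply/funext => m; apply/funext => s.
  rewrite sym_mul_fun; have [s2|/eqP s2] := eqVneq (size s) 2%N; last first.
    by rewrite homogeneous_quadratic// bvt.2// mulr0.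
  case: s s2 => [|alpha [|beta []]]// _.
  rewrite /quadratic; under eq_bigr do rewrite sym_mul_fun sym_mul_vf2.
  have [cm|/(bump_off rhoP) rm] := pselect (cdom c m); last first.
    by rewrite /chi rm mul0r mul0r big1// => i _; rewrite /f rm !mul0r.
  have half al be : \sum_(p : 'I_n * 'I_n) f p.1 p.2 m *
      (pairing al (E p.1 m) * pairing be (E p.2 m)) = rho m ^+ 3 * vt m [:: al; be].
    rewrite (bivector_coordE _ _ ac cm) -(pair_big xpredT xpredT (fun i j => f i j m *
      (pairing al (E i m) * pairing be (E j m))))/= mulr_sumr.
    apply: eq_bigr => i _; rewrite mulr_sumr; apply: eq_bigr => j _.
    rewrite !pE /f; move: (rho m) (bivector_coord _ _ _ _) (pairing al _) (pairing be _).
    by move=> r x y z; ring.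
  under eq_bigr do rewrite mulrDr.
  rewrite big_split/= !half (symf2C m beta alpha svt) /chi.
  by move: (vt m _) (rho m) => x r; ring.
have := quadratic_poisson sB a sE sf fC svt bvt.2 Bvt schi chi0 dchi QE.
set V := tcoord c m0 (sharp vt m0 a).
have wE k : \sum_l f k l m0 * pairing a (E l m0) = rho m0 ^+ 2 * V 0 k.
  rewrite /V -pairing_coord_covec// pairing_sharp//.
  rewrite {2}(covec_sum a ac cm0) symf_suml// mulr_sumr; apply: eq_bigr => l _.
  rewrite pE /f (bivector_coordC c k l) -/(bivector_coord c l k m0).
  by move: (rho m0) (bivector_coord _ _ _ _) (pairing a _) => r x y; ring.
have inner k : \sum_i \sum_j vf_act (E k) (f i j) m0 *
      (pairing a (E i m0) * pairing a (E j m0)) = rho m0 ^+ 4 *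
    \sum_i \sum_j 'D_(delta_mx 0 k) (bivector_coord c i j \o cinv c) (cmap c m0) * (ai i * ai j).
  rewrite mulr_sumr; apply: eq_bigr => i _; rewrite mulr_sumr; apply: eq_bigr => j _.
  rewrite [vf_act _ _ _](act k (bivector_coord c i j) (smooth_bivector_coord i j ac)) !pE.
  move: (rho m0) (derive _ _ _) (pairing a _) (pairing a _) => r x y z.
  by ring.
(* Each factor of type w carries rho^2 and the inner sum rho^4, so the two sums carry rho^6 and
   rho^4. *)
move=> H; apply: (mulfI (expf_neq0 4 r0)); rewrite mulr0 -[RHS]H mulrDr.
congr (_ + _).
  rewrite mulrA -exprD mulr_sumr; apply: eq_bigr => k _; rewrite wE inner.
  move: (rho m0) (V 0 k) (\sum_i _) => r x y.
  by ring.
rewrite mulr_sumr; apply: eq_bigr => i _; rewrite mulr_sumr; apply: eq_bigr => k _.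
rewrite !wE; move: (rho m0) (V 0 i) (V 0 k) (_ + _) => r x y z.
by ring.
Qed.

End PoissonEquation.

(** * Conservation *)

(* A and v are the components of the covector curve and of the velocity at one
   instant, T those of the bivector field, d their partial derivatives, N i k
   the value of the covector on nabla_(E_i) E_k, and r = rho^2. *)
Lemma conservation_identity (R : realFieldType) n (r : R)
    (A dA v dV : 'I_n -> R) (T N : 'I_n -> 'I_n -> R)
    (d : 'I_n -> 'I_n -> 'I_n -> R) :
  r != 0 -> (forall i j, T i j = T j i) ->
  (forall i, v i = \sum_j T i j * A j) ->
  (forall i, dV i = \sum_j (T i j * dA j + A j * \sum_k v k * d k i j)) ->
  r * (\sum_i dV i * A i) + \sum_i \sum_j v i * v j * N j i = 0 ->
  r * (\sum_k v k * \sum_i \sum_j d k i j * (A i * A j)) +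
    \sum_i \sum_k v i * v k * (N i k + N k i) = 0 ->
  \sum_i (A i * dV i + v i * dA i) = 0.
Proof.
move=> r0 TC vE dVE geo poi; rewrite big_split/=.
set S1 := \sum_i A i * dV i; set S2 := \sum_i v i * dA i.
set Q := (X in r * X + _ = 0) in poi.
set N1 := (X in _ + X = 0) in geo.
have S1E : \sum_i dV i * A i = S1 by apply: eq_bigr => i _; rewrite mulrC.
have N2E : \sum_i \sum_k v i * v k * (N i k + N k i) = N1 + N1.
  under eq_bigr => i _ do under eq_bigr => k _ do rewrite mulrDr.
  under eq_bigr do rewrite big_split/=.
  rewrite big_split/=; congr (_ + _); rewrite exchange_big/=.
  by apply: eq_bigr => i _; apply: eq_bigr => k _; rewrite [v k * _]mulrC.
(* Contract the differentiated relation v = T A with A: by the symmetry of T the part with [dA]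
   becomes S2, and the derivatives of T give Q. *)
have S1Q : S1 = S2 + Q.
  rewrite /S1; under eq_bigr do rewrite dVE big_split/= mulrDr.
  rewrite big_split/=; congr (_ + _).
    under eq_bigr do rewrite mulr_sumr.
    rewrite exchange_big/=; apply: eq_bigr => j _.
    by rewrite vE mulr_suml; apply: eq_bigr => i _; rewrite (TC i j); ring.
  rewrite /Q; under [RHS]eq_bigr do rewrite mulr_sumr.
  rewrite [RHS]exchange_big/=; apply: eq_bigr => i _.
  rewrite mulr_sumr; under [RHS]eq_bigr do rewrite mulr_sumr.
  rewrite [RHS]exchange_big/=; apply: eq_bigr => j _.
  by rewrite mulrA mulr_sumr; apply: eq_bigr => k _; ring.
rewrite S1E in geo; rewrite N2E in poi.
apply: (mulfI r0); rewrite mulr0.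
(* Since S1 + S2 = 2 S1 - Q, twice the geodesic equation minus the Poisson equation leaves this sum,
   and the connection terms cancel. *)
have -> : r * (S1 + S2) = (r * S1 + N1) *+ 2 - (r * Q + (N1 + N1)).
  by rewrite S1Q; ring.
by rewrite geo poi mul0rn subr0.
Qed.

(** * Vanishing of the derivative of the squared speed *)

Section Conservation.
Variables (R : realType) (n : nat) (M : smooth_manifold R n).
Variables (vt : symfield M) (I : set R) (gamma : R -> M) (a : R -> 'cV[R]_n).
Hypotheses (bvt : is_sym_bivector vt) (oI : open I) (sgamma : smooth_curve I gamma).
Hypotheses (sa : smooth_cf_along I gamma a)
  (va : forall t, I t -> sharp vt (gamma t) (a t) = velocity gamma t).
Variable nabla : (M -> 'rV[R]_n) -> (M -> 'rV[R]_n) -> M -> 'rV[R]_n.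
Hypotheses (pvt : sym_poisson vt nabla) (gd : geodesic nabla I gamma).

Lemma is_derive_Sq t0 : I t0 -> is_derive t0 1 (Sq vt gamma) 0.
Proof.
move=> It0; have svt := bvt.1.
have [_ cn _ [B sB Bvt]] := pvt; have [_ [D cD Dv]] := gd.
set m0 := gamma t0; pose c := chart_at m0.
have ac : atlas M c by exact: chart_at_atlas.
have ct0 : cdom c (gamma t0) by exact: chart_at_dom.
have [K [rho rhoP]] := ex_bump ct0.
have r0 := bump_neq0 rhoP.
pose U := I `&` gamma @^-1` cdom c.
have oU : open U by exact: open_curve_dom.
have Ut0 : U t0 by [].
have nU : nbhs t0 U := open_nbhs_nbhs (conj oU Ut0).
pose ai i t := pairing (a t) (coord_vec c (gamma t) i).
pose V i t := tcoord c (gamma t) (velocity gamma t) 0 i.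
pose th i j := bivector_coord vt c i j \o cinv c.
pose x0 := cmap c m0.
have Da i : derivable (ai i) t0 1 by apply: (derivable_on (sa i ac)).
have DV i : derivable (V i) t0 1.
  by apply: (@derivable_on _ _ U) => // k; exact: smooth_velocity_coord.
have VE i t : U t -> V i t = \sum_j th i j (cmap c (gamma t)) * ai j t.
  move=> [It ct]; rewrite /V -va// -pairing_coord_covec// pairing_sharp//.
  rewrite {1}(covec_sum (a t) ac ct) symf_suml//; apply: eq_bigr => j _.
  by rewrite mulrC /th /= cmapK// bivector_coordC.
have Dx := curve_derivable sgamma ac It0 ct0.
have DxE k : ('D_1 (cmap c \o gamma) t0) 0 k = V k t0.
  by rewrite /V (tcoord_velocity sgamma ac It0 ct0).
have Dth i j : is_derive t0 (1 : R) (th i j \o (cmap c \o gamma))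
    (\sum_k V k t0 * 'D_(delta_mx 0 k) (th i j) x0).
  have := C1_is_derive_comp (@cimg_open _ _ _ c)
    (smooth_bivector_coord bvt i j ac 1%N) (cimg_cmap ct0) Dx.
  by under eq_bigr do rewrite DxE.
have DVE i : 'D_1 (V i) t0 = \sum_j (th i j x0 * 'D_1 (ai j) t0 +
    ai j t0 * \sum_k V k t0 * 'D_(delta_mx 0 k) (th i j) x0).
  have dj j := is_deriveM (Dth i j) (derivableP (Da j)).
  have [_ <-] := is_derive_sum dj; apply: near_eq_derive.
  by apply: filterS nU => t /(VE i) ->; rewrite fct_sumE.
have geo := geodesic_equation oI sgamma ac It0 ct0 rhoP cn cD (Dv t0 It0).
have poi := poisson_equation bvt rhoP (a t0) sB Bvt.
have SqE : is_derive t0 (1 : R) (Sq vt gamma)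
    (\sum_i (ai i t0 * 'D_1 (V i) t0 + V i t0 * 'D_1 (ai i) t0)).
  have di i := is_deriveM (derivableP (Da i)) (derivableP (DV i)).
  apply: near_eq_is_derive (is_derive_sum di).
  apply: filterS nU => t [It ct]; rewrite fct_sumE.
  by rewrite (Sq_coord svt (va It) ac ct).
apply: is_derive_eq SqE _.
apply: (conservation_identity (r := rho m0 ^+ 2) (T := fun i j => th i j x0)
  (N := fun i j => pairing (a t0) (nabla (frame c rho i) (frame c rho j) m0))
  _ _ _ DVE).
- by rewrite expf_neq0.
- by move=> i j; rewrite /th bivector_coordC.
- by move=> i; exact: VE.
(* The vector equation of the geodesic enters only through its pairing with the covector at [t0]. *)
- have := congr1 (pairing (a t0)) geo.
  have p0 : pairing (a t0) 0 = 0 by rewrite /pairing mul0mx mxE.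
  have pZ (k : R) v : pairing (a t0) (k *: v) = k * pairing (a t0) v.
    by rewrite /pairing -scalemxAl mxE.
  have pD v w : pairing (a t0) (v + w) = pairing (a t0) v + pairing (a t0) w.
    by rewrite /pairing mulmxDl mxE.
  rewrite p0 pD pZ !pairing_sum => G; rewrite -[RHS]G.
  congr (_ * _ + _).
    by apply: eq_bigr => i _; rewrite pZ.
  by apply: eq_bigr => i _; rewrite pairing_sum; apply: eq_bigr => j _; rewrite pZ.
- by move: poi; rewrite va.
Qed.

End Conservation.

Lemma is_derive0_constant (R : realType) (I : set R) (f : R -> R) :
  is_interval I -> (forall t, I t -> is_derive t 1 f 0) ->
  exists k, forall t, I t -> f t = k.
Proof.
move=> itvI df.
have eq_lt s t : I s -> I t -> s < t -> f s = f t.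
  move=> Is It st.
  have Ist u : u \in `[s, t]%R -> I u.
    by rewrite in_itv/= => stu; apply: itvI Is It u stu.
  have [||u _] := @MVT R f (fun _ => 0) s t st.
  - by move=> u /subset_itv_oo_cc /Ist /df.
  - apply: derivable_within_continuous => u /Ist /df du; exact: ex_derive.
  - by rewrite mul0r => /eqP; rewrite subr_eq0 => /eqP.
(* An interval may be empty, and then any constant will do. *)
have [[s Is]|nI] := pselect (exists s, I s); last first.
  by exists 0 => t It; case: nI; exists t.
exists (f s) => t It; case: (ltgtP s t) => [st|ts|-> //].
  by rewrite (eq_lt s t).
exact: eq_lt.
Qed.

Theorem proposition4p17 (R : realType) (n : nat) (M : smooth_manifold R n)
    (vt : symfield M) (I : set R) (gamma : R -> M) :
  is_sym_bivector vt -> open I -> is_interval I -> admissible vt I gamma ->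
  smooth_on I (Sq vt gamma) /\
  (forall nabla : (M -> 'rV[R]_n) -> (M -> 'rV[R]_n) -> M -> 'rV[R]_n,
     sym_poisson vt nabla -> geodesic nabla I gamma ->
     exists k : R, forall t, I t -> Sq vt gamma t = k).
Proof.
move=> bvt oI itvI [sgamma [a sa va]]; split.
  exact: smooth_Sq bvt.1 sa va.
move=> nabla pvt gd; apply: is_derive0_constant => // t It.
exact: (is_derive_Sq bvt oI sgamma sa va pvt gd It).
Qed.
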